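(* Let $n\geq 2$, $1\leq k\leq n-1$, and $q=p^h$ with $p$ prime and $h\geq 1$. If $p=7$, there is no codeword of $\mathrm{C}_k(n,q)$ with weight in the open interval $]\theta_k, (12\theta_k+2)/7[$. If $p>7$, there is no codeword of $\mathrm{C}_k(n,q)$ with weight in the open interval $]\theta_k,(12\theta_k+6)/7[$.
   Context: $\mathrm{PG}(n,q)$ is the $n$-dimensional projective space over $\mathbb{F}_q$, $q=p^h$; $\theta_m=(q^{m+1}-1)/(q-1)$. $\mathrm{C}_k(n,q)$ is the $p$-ary linear code (a subspace of $\mathbb{F}_p^{\theta_n}$, coordinates indexed by the points of $\mathrm{PG}(n,q)$) spanned over $\mathbb{F}_p$ by the incidence vectors of the $k$-dimensional subspaces of $\mathrm{PG}(n,q)$. The weight of a vector is its number of nonzero coordinates. *)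

(* Defs.v *)
From HB Require Import structures.
From mathcomp Require Import all_boot all_order all_algebra all_field.
Set Implicit Arguments. Unset Strict Implicit. Unset Printing Implicit Defensive.
Import GRing.Theory.

(* PG(n,q) is modelled via the vector space F^(n+1), F a finite field with q
   elements.  A subspace of F^(n+1) is represented canonically by the square
   matrix <<M>>%MS (genmx) spanning it: M represents a subspace iff M = <<M>>.
   Projective dimension d  <->  vector rank d+1. *)

Definition proj_subspaces (F : finFieldType) (n d : nat) : {set 'M[F]_(n.+1)} :=
  [set M : 'M[F]_(n.+1) | (M == genmx M) && (\rank M == d.+1)].

Definition points (F : finFieldType) (n : nat) := proj_subspaces F n 0.

Definition theta (q m : nat) : nat := (q ^ m.+1 - 1) %/ (q - 1).

(* The codeword of C_k(n,q) (over F_p) that is the F_p-linear combination,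
   with coefficients a S, of the incidence vectors of the k-subspaces S;
   coordinate at point P. Every codeword is of this form. *)
Definition comb (F : finFieldType) (p n k : nat) (a : {ffun 'M[F]_(n.+1) -> 'F_p})
  (P : 'M[F]_(n.+1)) : 'F_p :=
  (\sum_(S in proj_subspaces F n k) (a S * ((P <= S)%MS)%:R)%R)%R.

Definition weight (F : finFieldType) (p n : nat) (c : 'M[F]_(n.+1) -> 'F_p) : nat :=
  #|[set P in points F n | c P != 0%R]|.

(* Main.v *)
Require Import Defs.
From mathcomp Require Import all_boot all_order all_algebra all_field.
From mathcomp Require Import zify.
Set Implicit Arguments. Unset Strict Implicit. Unset Printing Implicit Defensive.
Import GRing.Theory.
Local Open Scope ring_scope.

(** A codeword of [C_k(n,q)] is lifted to the function [f v = \sum_S a_S [v \in S]] on all vectors,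
    zero included, so that [f 0 = \sum_S a_S], and [f] sums to [0] on every subspace of rank at
    least [n - k + 1].

    If [f 0 = 0], let [v] be in the support and let [Y] be a subspace of rank [n - k] meeting the
    support in the multiples of [v] only.  On every other coset of [Y] the values of [f] add up to
    [- f v], so the representatives of [f / f v] in [0, p - 1] add up to at least [p - 1].  Adding
    the resulting inequality to the one for a vector with value [- f v] gives
    [p w >= 2 (p - 1) theta_k + 2].

    If [f 0 <> 0], regard [F^(n+1)] as a vector space over the prime field: [f] is then a
    combination of indicators of [F_p]-subspaces of rank [K = h (k + 1)], and it is enough to show
    that such an [f], normalised by [f 0 = 1], with fewer than [p^(K-2) (2 p (p - 1) + 1)] nonzero
    values is the indicator of a subspace.  For [K = 2], [f] is orthogonal to every product of
    [p - 1] linear forms; the at most [2 p - 2] points of the support other than a given [Q] can be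
    covered in pairs by [p - 1] hyperplanes missing [Q], unless the support contains a line through
    [Q]; hence the support is a line.  For larger [K], some hyperplane cuts [f] in the indicator of
    a subspace [A] of rank [K - 1] (a tangent hyperplane), and averaging over pencils yields
    further tangent hyperplanes through almost every codimension-two subspace of the first one.
    The corresponding subspaces span a single [P] of rank [K] and cover more than half of it, so
    [f - 1_P] is too light to be a nonzero word of the first kind. *)

(** * Counting and summing over row spaces and their cosets *)

Section RowSpaces.
Variables (F : finFieldType) (N : nat).
Implicit Types (v u : 'rV[F]_N) (U Y A : 'M[F]_N).

Lemma card_rowspace (m : nat) (U : 'M[F]_(m, N)) :
  #|[set v : 'rV[F]_N | (v <= U)%MS]| = (#|F| ^ \rank U)%N.
Proof.
have -> : [set v : 'rV[F]_N | (v <= U)%MS] =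
    [set x *m row_base U | x in [set: 'rV[F]_(\rank U)]].
  apply/setP=> v; rewrite inE -(eq_row_base U); apply/submxP/imsetP.
    by case=> x ->; exists x.
  by case=> x _ ->; exists x.
rewrite card_imset; last exact: row_free_inj (row_base_free U).
by rewrite cardsT card_mx mul1n.
Qed.

Lemma sum_rowspace1 (m : nat) (U : 'M[F]_(m, N)) :
  (\sum_(v : 'rV[F]_N | (v <= U)%MS) 1 = #|F| ^ \rank U)%N.
Proof. by rewrite -card_rowspace -sum1_card; apply: eq_bigl => v; rewrite inE. Qed.

Lemma sum_translate (R : nmodType) Y (y : 'rV[F]_N) (G : 'rV[F]_N -> R) :
  (y <= Y)%MS -> \sum_(v | ~~ (v <= Y)%MS) G (v + y) = \sum_(v | ~~ (v <= Y)%MS) G v.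
Proof.
move=> yY; rewrite [RHS](reindex_inj (addIr y)) /=; apply: eq_bigl => v.
congr (~~ _); apply/idP/idP => [vY|]; first exact: addmx_sub.
by move=> vY; rewrite -[v](addrK y) addmx_sub ?eqmx_opp.
Qed.

(** Translation by [Y] permutes the vectors outside [Y], so adding up the coset sums over all
    outside [v] counts each value [#|F| ^ \rank Y] times; dividing leaves the number of cosets other
    than [Y]. *)
Lemma sum_cosets_ge Y (c : nat) (G : 'rV[F]_N -> nat) :
  (forall v, ~~ (v <= Y)%MS -> c <= \sum_(y | (y <= Y)%MS) G (v + y)%R)%N ->
  (c * (#|F| ^ (N - \rank Y) - 1) <= \sum_(v | ~~ (v <= Y)%MS) G v)%N.
Proof.
move=> cG; have q0 : (0 < #|F| ^ \rank Y)%N by rewrite expn_gt0 (ltnW (finNzRing_gt1 F)).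
rewrite -(leq_pmul2l q0).
have -> : (#|F| ^ \rank Y * \sum_(v | ~~ (v <= Y)%MS) G v)%N =
    (\sum_(v | ~~ (v <= Y)%MS) \sum_(y | (y <= Y)%MS) G (v + y)%R)%N.
  rewrite exchange_big /= -sum_rowspace1 big_distrl /=.
  by apply: eq_bigr => y yY; rewrite mul1n (sum_translate G yY).
have -> : (#|F| ^ \rank Y * (c * (#|F| ^ (N - \rank Y) - 1)) =
    \sum_(v : 'rV[F]_N | ~~ (v <= Y)%MS) c)%N.
  have e : (\sum_(v : 'rV[F]_N | (v <= Y)%MS) 1 +
     \sum_(v : 'rV[F]_N | ~~ (v <= Y)%MS) 1 = #|F| ^ N)%N.
    by rewrite -(bigID (fun v : 'rV[F]_N => (v <= Y)%MS) xpredT (fun=> 1%N)) /= sum1_card card_mx mul1n.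
  rewrite sum_rowspace1 in e.
  have -> : (\sum_(v : 'rV[F]_N | ~~ (v <= Y)%MS) c =
     c * \sum_(v : 'rV[F]_N | ~~ (v <= Y)%MS) 1)%N.
    by rewrite big_distrr /=; apply: eq_bigr => v _; rewrite muln1.
  have -> : (\sum_(v : 'rV[F]_N | ~~ (v <= Y)%MS) 1 = #|F| ^ N - #|F| ^ \rank Y)%N.
    by rewrite -e addKn.
  rewrite mulnCA mulnBr muln1 -expnD subnKC ?rank_leq_row //.
exact: leq_sum.
Qed.

Lemma sum_line (R : nmodType) v (G : 'rV[F]_N -> R) : v != 0 ->
  \sum_(u | (u <= v)%MS) G u = \sum_(a : F) G (a *: v).
Proof.
move=> v0; have inj : injective (fun a : F => a *: v).
  by move=> a b /eqP; rewrite -subr_eq0 -scalerBl scaler_eq0 (negPf v0) orbF subr_eq0 => /eqP.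
transitivity (\sum_(u in [set a *: v | a in [set: F]]) G u).
  apply: eq_bigl => u; apply/sub_rVP/imsetP; last by case=> a _ ->; exists a.
  by case=> a ->; exists a.
rewrite big_imset /=; last by move=> a b _ _; exact: inj.
by apply: eq_bigl => a; rewrite inE.
Qed.

Lemma sum_adds_line (R : nmodType) Y v (G : 'rV[F]_N -> R) : ~~ (v <= Y)%MS ->
  \sum_(u | (u <= Y + v)%MS) G u = \sum_(a : F) \sum_(y | (y <= Y)%MS) G (a *: v + y).
Proof.
move=> vY.
(* Each [u] has a unique coefficient along [v] modulo [Y]. *)
have e u : (u <= Y + v)%MS -> exists a, forall b, (u - b *: v <= Y)%MS = (b == a).
  case/sub_addsmxP=> -[x y] /= ->; rewrite [y]mx11_scalar mul_scalar_mx.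
  exists (y 0 0) => b; rewrite -addrA -scalerBl.
  have xY : (x *m Y <= Y)%MS by exact: submxMl.
  apply/idP/eqP=> [h|->]; last by rewrite subrr scale0r addr0.
  apply/eqP; apply: contraR vY => ne.
  have : ((y 0 0 - b) *: v <= Y)%MS.
    by rewrite -[_ *: v](addKr (x *m Y)) addmx_sub // eqmx_opp.
  by rewrite eqmx_scale // subr_eq0 eq_sym.
transitivity (\sum_(u | (u <= Y + v)%MS) \sum_(a | (u - a *: v <= Y)%MS) G u).
  apply: eq_bigr => u /e[a ea]; rewrite (big_pred1 a) // => b; exact: ea.
rewrite (exchange_big_dep xpredT) //=; apply: eq_bigr => a _.
rewrite (reindex_inj (addrI (a *: v))) /=; apply: eq_bigl => y.
rewrite addrAC subrr add0r; case: (boolP (y <= Y)%MS) => yY; last by rewrite andbF.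
by rewrite andbT addmx_sub ?scalemx_sub ?addsmxSr // (submx_trans yY) ?addsmxSl.
Qed.

End RowSpaces.

(** * Linear combinations of subspace indicators *)

Definition support_card (F : finFieldType) (N p : nat) (f : 'rV[F]_N -> 'F_p) : nat :=
  #|[set v | f v != 0]|.

(** Ranks are only bounded below because a hyperplane section lowers a rank by one or not at all. *)
Definition subspace_comb (F : finFieldType) (N p K : nat) (f : 'rV[F]_N -> 'F_p) : Prop :=
  exists2 s : seq ('F_p * 'M[F]_N), {in s, forall x, (K <= \rank x.2)%N} &
    forall v, f v = \sum_(x <- s) x.1 * ((v <= x.2)%MS)%:R.

Lemma support_cardE (F : finFieldType) (N p : nat) (f : 'rV[F]_N -> 'F_p) :
  support_card f = (\sum_v (f v != 0%R))%N.
Proof. by rewrite /support_card -sum1dep_card big_mkcond; apply: eq_bigr => v _; case: eqP. Qed.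

Definition restrict (F : finFieldType) (N p : nat) (f : 'rV[F]_N -> 'F_p) (H : 'M[F]_N) :
  'rV[F]_N -> 'F_p := fun v => f v * ((v <= H)%MS)%:R.

Section Combinations.
Variables (F : finFieldType) (N p K : nat).
Implicit Types (f : 'rV[F]_N -> 'F_p) (U S A : 'M[F]_N).

Lemma comb_scale f (c : 'F_p) :
  subspace_comb K f -> subspace_comb K (fun v => c * f v).
Proof.
case=> s sK sf; exists [seq (c * x.1, x.2) | x <- s].
  by move=> _ /mapP[x xs ->]; apply: (sK x xs).
by move=> v; rewrite sf big_map big_distrr /=; apply: eq_bigr => x _; rewrite mulrA.
Qed.

Lemma comb_sub_indicator f A : (K <= \rank A)%N ->
  subspace_comb K f -> subspace_comb K (fun v => f v - ((v <= A)%MS)%:R).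
Proof.
move=> KA [s sK sf]; exists ((-1, A) :: s).
  by move=> x; rewrite inE => /predU1P[->|/sK].
by move=> v; rewrite big_cons sf /= mulN1r addrC.
Qed.

Lemma comb_hom f (a : F) v : subspace_comb K f -> a != 0 -> f (a *: v) = f v.
Proof.
case=> s _ sf a0; rewrite !sf; apply: eq_bigr => x _.
by rewrite eqmx_scale.
Qed.

End Combinations.

Lemma comb_restrict (F : finFieldType) (N p K : nat) (f : 'rV[F]_N -> 'F_p)
    (H : 'M[F]_N) : (N <= (\rank H).+1)%N -> subspace_comb K.+1 f ->
  subspace_comb K (restrict f H).
Proof.
move=> rH [s sK sf]; exists [seq (x.1, (x.2 :&: H)%MS) | x <- s].
  move=> _ /mapP[x xs ->] /=; have := mxrank_sum_cap x.2 H.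
  have := rank_leq_col (x.2 + H)%MS; have := sK x xs => /=; lia.
move=> v; rewrite /restrict sf big_map big_distrl /=; apply: eq_bigr => x _.
by rewrite sub_capmx -mulrA -natrM mulnb.
Qed.

Lemma card_nz_scalars (F : finFieldType) : #|[pred a : F | a != 0]| = #|F|.-1.
Proof. by rewrite -(cardC1 (0 : F)); apply: eq_card => a; rewrite !inE. Qed.

Section CharacteristicP.
Variables (F : finFieldType) (N p : nat).
Hypotheses (p_pr : prime p) (p_dvd_q : (p %| #|F|)%N).
Implicit Types (f : 'rV[F]_N -> 'F_p) (U S A Y : 'M[F]_N).

Lemma natr_cardF : (#|F|)%:R = 0 :> 'F_p.
Proof. by apply/eqP; rewrite -(dvdn_pcharf (pchar_Fp p_pr)). Qed.

(** Each subspace of the combination meets [U] in a nonzero space, whose number of vectors is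
    divisible by [p]. *)
Lemma comb_sum_eq0 K f U : subspace_comb K f -> (N < \rank U + K)%N ->
  \sum_(v | (v <= U)%MS) f v = 0.
Proof.
case=> s sK sf UK; under eq_bigr do rewrite sf.
rewrite exchange_big big_seq big1 //= => x /sK /= xK; rewrite -big_distrr /=.
rewrite -natr_sum [X in X%:R](_ : _ = #|F| ^ \rank (U :&: x.2)%MS)%N; last first.
  rewrite -sum_rowspace1 big_mkcond [RHS]big_mkcond /=.
  by apply: eq_bigr => v _; rewrite sub_capmx; case: (v <= U)%MS; case: (v <= x.2)%MS.
have := mxrank_sum_cap U x.2; have := rank_leq_col (U + x.2)%MS.
move: xK UK; case: (\rank (U :&: x.2)%MS) => [|m] ? ? ? ?; first by lia.
by rewrite expnS natrM natr_cardF mul0r mulr0.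
Qed.

(* Summing over [Y + <v>] groups the vectors outside [Y] into [q - 1] copies of the coset [v + Y]. *)
Lemma sum_coset f Y v : (forall (a : F) u, a != 0 -> f (a *: u) = f u) ->
  ~~ (v <= Y)%MS -> \sum_(u | (u <= Y + v)%MS) f u = 0 ->
  \sum_(y | (y <= Y)%MS) f (v + y) = \sum_(y | (y <= Y)%MS) f y.
Proof.
move=> fh vY; rewrite sum_adds_line // (bigD1 0) //=.
under eq_bigr do rewrite scale0r add0r.
have e (a : F) : a != 0 -> \sum_(y | (y <= Y)%MS) f (a *: v + y) =
    \sum_(y | (y <= Y)%MS) f (v + y).
  move=> a0; have inj : injective (fun y : 'rV[F]_N => a *: y) by exact: scalerI.
  rewrite (reindex_inj inj) /=; apply: eq_big => y; first by rewrite eqmx_scale.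
  by rewrite -scalerDr fh.
rewrite (eq_bigr _ e) sumr_const => /eqP; rewrite addr_eq0 => /eqP ->.
rewrite card_nz_scalars -mulr_natr; have := natr_cardF; have := finNzRing_gt1 F.
case: #|F| => // q _; rewrite -natr1 /= => /eqP; rewrite addr_eq0 => /eqP ->.
by rewrite mulrN1 opprK.
Qed.

End CharacteristicP.

(** * Subspaces meeting the support in a single point *)

Section Avoiding.
Variables (F : finFieldType) (N p : nat).
Implicit Types (f : 'rV[F]_N -> 'F_p) (Y : 'M[F]_N).

(** [Y] has at least [#|F| ^ m - 1] cosets other than itself, too many for each to contain a support
    vector. *)
Lemma exists_coset_free f Y (m : nat) : (support_card f < #|F| ^ m - 1)%N ->
  (m + \rank Y <= N)%N ->
  exists2 v, ~~ (v <= Y)%MS & forall y, (y <= Y)%MS -> f (v + y) = 0.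
Proof.
move=> fm mY.
case: (boolP [exists v, ~~ (v <= Y)%MS && [forall y, (y <= Y)%MS ==> (f (v + y) == 0)]]).
  case/existsP=> v /andP[vY /forallP fv]; exists v => // y yY.
  by have := fv y; rewrite yY => /eqP.
rewrite negb_exists => /forallP fv; exfalso; move: fm; apply/negP; rewrite -leqNgt.
have -> : support_card f = (\sum_(v | (v <= Y)%MS) (f v != 0%R) + \sum_(v | ~~ (v <= Y)%MS) (f v != 0%R))%N.
  by rewrite support_cardE (bigID (fun v => (v <= Y)%MS)).
apply: leq_trans (leq_addl _ _).
apply: leq_trans (leq_sub2r _ (leq_pexp2l _ _)) _; last first.
- rewrite -[X in (X <= _)%N]mul1n; apply: sum_cosets_ge => v vY.
  have := fv v; rewrite vY /= negb_forall => /existsP[y].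
  by rewrite negb_imply => /andP[yY fy]; rewrite (bigD1 y) //= fy.
- by rewrite -(leq_add2r (\rank Y)) subnK ?rank_leq_row.
- exact: ltnW (finNzRing_gt1 F).
Qed.

(** [Y] grows one dimension at a time from the span of [v], by adjoining some [x] whose coset
    [x + Y] avoids the support. By homogeneity every vector of the new space outside [Y] is a
    multiple of one in that coset, so no support is gained. *)
Lemma exists_avoiding K f (v : 'rV[F]_N) : (forall (a : F) u, a != 0 -> f (a *: u) = f u) ->
  (K < N)%N -> v != 0 -> (support_card f < #|F| ^ K.+1 - 1)%N ->
  exists Y, [/\ \rank Y = (N - K)%N, (v <= Y)%MS &
    forall u, (u <= Y)%MS -> f u != 0 -> (u <= v)%MS].
Proof.
move=> fh KN v0 fK.
suff: forall m, (0 < m <= N - K)%N -> exists Y, [/\ \rank Y = m, (v <= Y)%MS &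
    forall u, (u <= Y)%MS -> f u != 0 -> (u <= v)%MS].
  by apply; rewrite leqnn andbT subn_gt0.
elim=> // -[|m] IH mN.
  by exists <<v>>%MS; rewrite !genmxE rank_rV v0; split=> // u; rewrite genmxE.
have /IH[Y [rY vY Yv]] : (0 < m.+1 <= N - K)%N by lia.
have mY : (K.+1 + \rank Y <= N)%N by lia.
have [x xY fx] := exists_coset_free fK mY.
exists (Y + x)%MS; split; last 1 first.
- move=> u /sub_addsmxP[[y z]] /=; rewrite [z]mx11_scalar mul_scalar_mx => eu.
  have yY : (y *m Y <= Y)%MS by exact: submxMl.
  have [z0|z0] := eqVneq (z 0 0) 0.
    by rewrite eu z0 scale0r addr0; exact: Yv.
  rewrite eu -(fh (z 0 0)^-1) ?invr_eq0 // scalerDr scalerA mulVf // scale1r addrC.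
  by rewrite fx ?eqxx // scalemx_sub.
- have := mxrank_adds_leqif Y x => -[le _].
  have x1 : (\rank x <= 1)%N by exact: rank_leq_row.
  have : (Y < Y + x)%MS by rewrite ltmxE addsmxSl /= addsmx_sub submx_refl.
  move/rank_ltmx; lia.
- by rewrite (submx_trans vY) ?addsmxSl.
Qed.
End Avoiding.

(** * Natural representatives of elements of the prime field *)

Definition Fp_nat (p : nat) (x : 'F_p) : nat := x.
Arguments Fp_nat : simpl never.

Section PrimeFieldValues.
Variable p : nat.
Hypothesis p_pr : prime p.

Lemma Fp_nat_lt (x : 'F_p) : (Fp_nat x < p)%N.
Proof. by rewrite /Fp_nat -[X in (_ < X)%N](Fp_cast p_pr) ltn_ord. Qed.

Lemma Fp_nat_gt0 (x : 'F_p) : x != 0 -> (0 < Fp_nat x)%N.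
Proof. by move=> x0; rewrite lt0n; apply: contra x0 => /eqP e; apply/eqP/val_inj. Qed.

Lemma Fp_natN (x : 'F_p) : x != 0 -> (Fp_nat x + Fp_nat (- x) = p)%N.
Proof.
move=> x0; have Nx0 : - x != 0 by rewrite oppr_eq0.
have : (Fp_nat x + Fp_nat (- x))%:R == 0 :> 'F_p.
  by rewrite natrD /Fp_nat !natr_Zp subrr.
rewrite -(dvdn_pcharf (pchar_Fp p_pr)) => /dvdnP[k].
have := Fp_nat_gt0 x0; have := Fp_nat_gt0 Nx0.
have := Fp_nat_lt x; have := Fp_nat_lt (- x).
case: k => [|[|k]]; nia.
Qed.

(** One more than the sum of the representatives is a positive multiple of [p]. *)
Lemma Fp_sum_nat_ge (I : finType) (P : pred I) (x : I -> 'F_p) :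
  \sum_(i | P i) x i = -1 -> (p - 1 <= \sum_(i | P i) Fp_nat (x i))%N.
Proof.
move=> e; have : (\sum_(i | P i) Fp_nat (x i)).+1%:R == 0 :> 'F_p.
  by rewrite -natr1 natr_sum; under eq_bigr do rewrite /Fp_nat natr_Zp; rewrite e addNr.
by rewrite -(dvdn_pcharf (pchar_Fp p_pr)) => /dvdn_leq; lia.
Qed.

End PrimeFieldValues.

(** * The weight bound for combinations vanishing at zero *)

Section DualWeight.
Variables (F : finFieldType) (N p K : nat) (f : 'rV[F]_N -> 'F_p).
Hypotheses (p_pr : prime p) (p_dvd_q : (p %| #|F|)%N) (K_gt0 : (0 < K)%N) (KN : (K < N)%N).
Hypotheses (fK : subspace_comb K f) (f0 : f 0 = 0).

Let fh (a : F) u : a != 0 -> f (a *: u) = f u.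
Proof. exact: comb_hom fK. Qed.

(** Inside [Y] only the nonzero multiples of [v] count, and they sum to [(#|F| - 1) * f v = - f v].
    As [f] sums to zero on each [Y + x], every other coset has the same sum. *)
Lemma avoiding_coset_sums v : f v != 0 -> (support_card f < #|F| ^ K.+1 - 1)%N ->
  exists Y : 'M[F]_N, [/\ \rank Y = (N - K)%N, (v <= Y)%MS &
    forall x, ~~ (x <= Y)%MS -> \sum_(y | (y <= Y)%MS) f (x + y) = - f v].
Proof.
move=> fv fs; have v0 : v != 0 by apply: contraNneq fv => ->; rewrite f0.
have [Y [rY vY Yv]] := exists_avoiding fh KN v0 fs.
exists Y; split=> // x xY; rewrite sum_coset //; last first.
  apply: comb_sum_eq0 fK _ => //.
  have : (Y < Y + x)%MS by rewrite ltmxE addsmxSl /= addsmx_sub submx_refl.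
  by move/rank_ltmx; lia.
transitivity (\sum_(y | (y <= v)%MS) f y).
  rewrite [RHS]big_mkcond [LHS]big_mkcond /=; apply: eq_bigr => y _.
  case: (boolP (y <= v)%MS) => yv; first by rewrite (submx_trans yv vY).
  by case: ifP => // yY; have [//|/(Yv _ yY)] := eqVneq (f y) 0; rewrite (negPf yv).
rewrite sum_line // (bigD1 0) //= scale0r f0 add0r.
rewrite (eq_bigr (fun=> f v)) => [|a a0]; last exact: fh.
rewrite sumr_const card_nz_scalars -mulr_natr.
have := natr_cardF p_pr p_dvd_q; have := finNzRing_gt1 F.
case: #|F| => // q _; rewrite -natr1 /= => /eqP; rewrite addr_eq0 => /eqP ->.
by rewrite mulrN1.
Qed.

(** Each of the [#|F| ^ K - 1] cosets other than [Y] contributes at least [p - 1], its sum being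
    [-1]; inside [Y] each nonzero multiple of [v] contributes at least one. *)
Lemma normalized_sum_ge v : f v != 0 -> (support_card f < #|F| ^ K.+1 - 1)%N ->
  ((p - 1) * (#|F| ^ K - 1) + (#|F| - 1) <= \sum_u Fp_nat (f u / f v)%R)%N.
Proof.
move=> fv fs; have [Y [rY vY Ys]] := avoiding_coset_sums fv fs.
rewrite [X in (_ <= X)%N](bigID (fun u => (u <= Y)%MS)) /= addnC leq_add //.
  have v0 : v != 0 by apply: contraNneq fv => ->; rewrite f0.
  apply: leq_trans (_ : \sum_(u | (u <= v)%MS) Fp_nat (f u / f v)%R <= _)%N.
    rewrite sum_line // (bigD1 0) //= -[X in (X <= _)%N]add0n leq_add //.
    rewrite subn1 -card_nz_scalars -sum1_card leq_sum // => a a0.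
    by apply: Fp_nat_gt0; rewrite fh // mulf_neq0 ?invr_eq0.
  rewrite [X in (X <= _)%N]big_mkcond [X in (_ <= X)%N]big_mkcond leq_sum //= => u _.
  by case: ifP => // uv; rewrite (submx_trans uv vY).
have -> : (#|F| ^ K = #|F| ^ (N - \rank Y))%N by rewrite rY subKn // ltnW.
apply: sum_cosets_ge => x xY; apply: Fp_sum_nat_ge => //.
by rewrite -big_distrl /= Ys // mulNr divff.
Qed.

(** If every coset other than [Y] held two support vectors, these and [v] would make the support too
    large. A coset with at most one has exactly one, whose value is the coset sum [- f v]. *)
Lemma exists_opposite_value v : f v != 0 ->
  (support_card f < 2 * (#|F| ^ K - 1) + 1)%N ->
  (support_card f < #|F| ^ K.+1 - 1)%N -> exists u, f u = - f v.
Proof.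
move=> fv fs2 fs; have [Y [rY vY Ys]] := avoiding_coset_sums fv fs.
case: (boolP [exists x, ~~ (x <= Y)%MS && (\sum_(y | (y <= Y)%MS) (f (x + y)%R != 0%R) < 2)%N]); last first.
  rewrite negb_exists => /forallP h; exfalso; move: fs2; apply/negP; rewrite -leqNgt.
  rewrite support_cardE (bigID (fun u => (u <= Y)%MS)) /= addnC leq_add //.
    by rewrite (bigD1 v) //= fv.
  have -> : (#|F| ^ K = #|F| ^ (N - \rank Y))%N by rewrite rY subKn // ltnW.
  apply: sum_cosets_ge => x xY; have := h x; by rewrite xY /= -leqNgt.
case/existsP=> x /andP[xY]; have Nv : - f v != 0 by rewrite oppr_eq0.
case: (boolP [exists y, (y <= Y)%MS && (f (x + y) != 0)]); last first.
  rewrite negb_exists => /forallP h; move: Nv; rewrite -(Ys x xY) big1 ?eqxx // => y yY.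
  by have := h y; rewrite yY /= negbK => /eqP.
case/existsP=> y /andP[yY fy]; rewrite (bigD1 y) //= fy add1n !ltnS leqn0 sum_nat_eq0 => /forallP h.
exists (x + y); rewrite -(Ys x xY) (bigD1 y) //= big1 ?addr0 // => z zY.
by have := h z; rewrite zY /= eqb0 negbK => /eqP.
Qed.

Lemma dual_weight_ge v : f v != 0 ->
  (2 * (p - 1) * (#|F| ^ K - 1) + 2 * (#|F| - 1) <= p * support_card f)%N.
Proof.
move=> fv; rewrite leqNgt; apply/negP => small.
have q2 := finNzRing_gt1 F; have p2 := prime_gt1 p_pr.
have qK : (#|F| <= #|F| ^ K)%N by rewrite -[X in (X <= _)%N]expn1 leq_pexp2l // ltnW.
have pq := dvdn_leq (ltnW q2) p_dvd_q.
(* A counterexample is light enough for the auxiliary lemmas: [p] times its support size is below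
   [2 * p * (#|F| ^ K - 1)]. *)
have fs2 : (support_card f < 2 * (#|F| ^ K - 1) + 1)%N.
  rewrite ltnNge; apply/negP => /(leq_mul (leqnn p)); move: small qK q2 p2.
  move: (support_card f) => s; move: (p) => p'; case: p' => [|p'] //; case: (#|F| ^ K)%N => [|X]; case: #|F| => [|q] //; nia.
have fs : (support_card f < #|F| ^ K.+1 - 1)%N.
  have : (2 * #|F| ^ K <= #|F| ^ K.+1)%N by rewrite expnS leq_mul2r q2 orbT.
  by lia.
have [u fu] := exists_opposite_value fv fs2 fs.
have fu0 : f u != 0 by rewrite fu oppr_eq0.
have h1 := normalized_sum_ge fv fs; have h2 := normalized_sum_ge fu0 fs.
(* The two normalisations are opposite, so at each support vector the representatives add up to
   [p]. *)
have : (\sum_w Fp_nat (f w / f v)%R + \sum_w Fp_nat (f w / f u)%R = p * support_card f)%N.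
  rewrite support_cardE big_distrr -big_split /=; apply: eq_bigr => w _.
  have [->|fw] := eqVneq (f w) 0; first by rewrite !mul0r muln0.
  rewrite muln1 fu invrN mulrN Fp_natN //; by rewrite mulf_neq0 ?invr_eq0.
nia.
Qed.

End DualWeight.

(** * Linear forms as column vectors, hyperplanes as their kernels *)

Section LinearForms.
Variables (F : finFieldType) (N : nat).
Implicit Types (v : 'rV[F]_N) (u : 'cV[F]_N) (A B : 'M[F]_N).

Definition form_at v u : F := (v *m u) 0 0.

Lemma form_atDl v1 v2 u : form_at (v1 + v2) u = form_at v1 u + form_at v2 u.
Proof. by rewrite /form_at mulmxDl mxE. Qed.
Lemma form_atDr v u1 u2 : form_at v (u1 + u2) = form_at v u1 + form_at v u2.
Proof. by rewrite /form_at mulmxDr mxE. Qed.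
Lemma form_atZl a v u : form_at (a *: v) u = a * form_at v u.
Proof. by rewrite /form_at -scalemxAl mxE. Qed.
Lemma form_atZr a v u : form_at v (a *: u) = a * form_at v u.
Proof. by rewrite /form_at -scalemxAr mxE. Qed.
Lemma form_at0l u : form_at 0 u = 0.
Proof. by rewrite /form_at mul0mx mxE. Qed.

Lemma sub_ker_form v u : (v <= kermx u)%MS = (form_at v u == 0).
Proof.
rewrite /form_at; apply/sub_kermxP/eqP=> [->|e]; first by rewrite mxE.
by apply/matrixP=> i j; rewrite !ord1 e mxE.
Qed.

Lemma rank_ker_form_ge u : (N <= (\rank (kermx u)).+1)%N.
Proof. by rewrite mxrank_ker; have := rank_leq_col u; lia. Qed.

Lemma submx_rank_ge m1 m2 (A : 'M[F]_(m1, N)) (B : 'M[F]_(m2, N)) :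
  (A <= B)%MS -> (\rank B <= \rank A)%N -> (B <= A)%MS.
Proof. by move=> AB r; rewrite -(geq_leqif (mxrank_leqif_sup AB)). Qed.

Lemma rank_cap_ker_form_ge A u : (\rank A <= (\rank (A :&: kermx u)%MS).+1)%N.
Proof.
have := mxrank_sum_cap A (kermx u); have := rank_leq_col (A + kermx u)%MS.
by have := rank_ker_form_ge u; lia.
Qed.

Lemma rank_cap_ker_form A u : ~~ (A <= kermx u)%MS ->
  \rank A = (\rank (A :&: kermx u)%MS).+1.
Proof.
move=> h; apply/eqP; rewrite eqn_leq rank_cap_ker_form_ge /=.
rewrite ltnNge; apply: contra h => h.
by have := submx_rank_ge (capmxSl A (kermx u)) h; rewrite sub_capmx => /andP[].
Qed.

Lemma exists_form1 v : v != 0 -> exists u, form_at v u = 1.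
Proof.
move=> v0; have [j vj] : exists j, v 0 j != 0.
  apply/existsP; apply: contraR v0; rewrite negb_exists => /forallP h.
  by apply/eqP/rowP=> j; rewrite mxE; apply/eqP; rewrite -[_ == _]negbK h.
exists ((v 0 j)^-1 *: delta_mx j 0); rewrite form_atZr /form_at -colE.
by rewrite !mxE mulVf.
Qed.

Lemma card_forms v (c : F) : v != 0 -> (\sum_u (form_at v u == c) = #|F| ^ N.-1)%N.
Proof.
move=> v0; have [u0 vu0] := exists_form1 v0.
have fib b : (\sum_u (form_at v u == b) = \sum_u (form_at v u == 0%R))%N.
  rewrite (reindex_inj (addIr (b *: u0))) /=; apply: eq_bigr => u _.
  by rewrite form_atDr form_atZr vu0 mulr1 -subr_eq0 addrK.
have e : (\sum_b \sum_u (form_at v u == b) = #|F| ^ N)%N.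
  have <- : #|{: 'cV[F]_N}| = (#|F| ^ N)%N by rewrite card_mx muln1.
  rewrite exchange_big /= -sum1_card; apply: eq_bigr => u _; rewrite (bigD1 (form_at v u)) //= eqxx big1 // => b.
  by rewrite eq_sym => /negPf ->.
have N0 : (0 < N)%N.
  clear -v0.
  by case: N v v0 => [|//] w; rewrite thinmx0 eqxx.
apply/eqP; rewrite -(eqn_pmul2l (ltnW (finNzRing_gt1 F))) -expnS prednK // -e fib.
by under [X in _ == X]eq_bigr do rewrite fib; rewrite sum_nat_const.
Qed.

Lemma card_forms_vanishing A : (\sum_(u : 'cV[F]_N) (A <= kermx u)%MS = #|F| ^ (N - \rank A))%N.
Proof.
have -> : (N - \rank A = \rank (kermx A^T))%N by rewrite mxrank_ker mxrank_tr.
rewrite -sum_rowspace1 [RHS]big_mkcond /=.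
rewrite (reindex (@trmx F 1 N)) /=; last by exists (@trmx F N 1) => w _; exact: trmxK.
apply: eq_bigr => w _.
rewrite -(_ : (A <= kermx w^T)%MS = (w <= kermx A^T)%MS); first by case: (_ <= _)%MS.
apply/sub_kermxP/sub_kermxP => e; last by rewrite -[LHS]trmxK trmx_mul trmxK e trmx0.
by rewrite -[LHS]trmxK trmx_mul trmxK e trmx0.
Qed.

End LinearForms.

(** * Averaging over hyperplanes *)

Section Averaging.
Variables (F : finFieldType) (N p : nat) (f : 'rV[F]_N -> 'F_p).
Hypotheses (fh : forall (a : F) v, a != 0 -> f (a *: v) = f v) (f0 : f 0 != 0).

Lemma support_card_ker (u : 'cV[F]_N) :
  support_card (restrict f (kermx u)) =
    (\sum_v (f v != 0%R) * (form_at v u == 0%R))%N.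
Proof.
rewrite support_cardE; apply: eq_bigr => v _; rewrite /restrict sub_ker_form.
by case: (form_at v u == 0); rewrite /= ?mulr1 ?mulr0 ?muln1 ?muln0 ?eqxx.
Qed.

Lemma support_fiber (u : 'cV[F]_N) (a : F) : a != 0 ->
  (\sum_v (f v != 0%R) * (form_at v u == a) =
   \sum_v (f v != 0%R) * (form_at v u == 1%R))%N.
Proof.
move=> a0; rewrite (reindex_inj (scalerI a0)) /=; apply: eq_bigr => v _.
by rewrite fh // form_atZl -{2}[a]mulr1 (inj_eq (mulfI a0)).
Qed.

(** The support splits into its kernel part and [#|F| - 1] fibres of equal size [B1 u], so it
    suffices that [#|F| * B1 u] reaches the support size. The zero form contributes nothing, so the
    average of [B1] over nonzero forms exceeds [(support_card f - 1) / #|F|]. *)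
Lemma exists_small_kernel : (1 < support_card f)%N -> exists u : 'cV[F]_N,
  (#|F| * support_card (restrict f (kermx u)) <= support_card f)%N.
Proof.
move=> b1; have q2 := finNzRing_gt1 F.
pose B1 (u : 'cV[F]_N) := (\sum_v (f v != 0%R) * (form_at v u == 1%R))%N.
have split_u u : (support_card f =
    support_card (restrict f (kermx u)) + (#|F| - 1) * B1 u)%N.
  rewrite support_cardE support_card_ker.
  transitivity (\sum_(a : F) \sum_v (f v != 0%R) * (form_at v u == a))%N.
    rewrite exchange_big /=; apply: eq_bigr => v _.
    rewrite (bigD1 (form_at v u)) //= eqxx muln1 big1 ?addn0 // => a.
    by rewrite eq_sym => /negPf ->; rewrite muln0.
  rewrite (bigD1 0) //=; congr (_ + _)%N.
  rewrite (eq_bigr (fun=> B1 u)) => [|a a0]; last exact: support_fiber.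
  by rewrite sum_nat_const card_nz_scalars subn1.
have sumB : (\sum_u B1 u = (support_card f - 1) * #|F| ^ N.-1)%N.
  rewrite exchange_big /= support_cardE (bigD1 0) //= [in RHS](bigD1 0) //= f0 addKn.
  rewrite big1 => [|u _]; last by rewrite form_at0l [0 == 1]eq_sym oner_eq0 ?muln0.
  rewrite add0n big_distrl /=; apply: eq_bigr => v v0.
  by rewrite -big_distrr /= card_forms.
have N0 : (0 < N)%N.
  rewrite lt0n; apply: contraTneq b1 => N0; rewrite -leqNgt /support_card.
  by apply: leq_trans (max_card _) _; rewrite card_mx N0 muln0.
have [u hu|h] := pickP (fun u => support_card f <= #|F| * B1 u)%N.
  exists u; have := split_u u; move: (support_card _) (support_card _) hu => x y.
  by move: (B1 u) q2 => z; case: #|F| => // q; nia.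
exfalso; have : (#|F| * \sum_u B1 u <= (support_card f - 1) * (#|F| ^ N - 1))%N.
  rewrite big_distrr /= (bigD1 0) //= [B1 0]big1 ?muln0 ?add0n => [|v _]; last first.
    by rewrite /form_at mulmx0 mxE [0 == 1]eq_sym oner_eq0 muln0.
  have -> : (#|F| ^ N - 1 = #|[pred u : 'cV[F]_N | u != 0%R]|)%N.
    by rewrite subn1 -[N in LHS]muln1 -card_mx -(cardC1 (0 : 'cV[F]_N)); apply: eq_card => u; rewrite !inE.
  rewrite mulnC -sum_nat_const leq_sum // => u _.
  have /negbT := h u; rewrite /= -ltnNge => lt; rewrite -ltnS; by rewrite subn1 prednK // ltnW.
rewrite sumB mulnCA -expnS prednK // leq_mul2l.
have : (0 < #|F| ^ N)%N by rewrite expn_gt0 (ltnW q2).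
lia.
Qed.

End Averaging.

(* If every linear form misses a value on [Z], Cauchy-Schwarz on the fibres bounds the number of
   pairs of [Z] not separated by a form from below; each pair is separated by most forms. *)
Lemma card_missing_values (F : finFieldType) (N : nat) (A : 'M[F]_N) (Z : {set 'rV[F]_N}) :
  (forall z, z \in Z -> (z <= A)%MS) ->
  (forall u : 'cV[F]_N, ~~ (A <= kermx u)%MS -> exists s, forall z, z \in Z -> form_at z u != s) ->
  (1 < \rank A)%N ->
  (2 * #|Z| <= (#|F| - 1) * #|F| ^ (\rank A).-1)%N.
Proof.
move=> ZA Zu rA; have q2 := finNzRing_gt1 F.
have [->|Z0] := eqVneq #|Z| 0%N; first by rewrite muln0.
pose Q (u : 'cV[F]_N) := (\sum_(z in Z) \sum_(w in Z) (form_at z u == form_at w u))%N.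
have N0 : (0 < N)%N by apply: leq_trans (rank_leq_col A); exact: ltnW.
have sumQ : (\sum_u Q u = #|Z| * #|F| ^ N + #|Z| * (#|Z| - 1) * #|F| ^ N.-1)%N.
  rewrite exchange_big /= -mulnA -mulnDr -sum_nat_const.
  apply: eq_bigr => z zZ; rewrite exchange_big /= (bigD1 z) //=; congr (_ + _)%N.
    under eq_bigr do rewrite eqxx.
    by rewrite sum1_card card_mx muln1.
  have -> : (#|Z| - 1 = #|[pred w | (w \in Z) && (w != z)]|)%N.
    by rewrite (cardsD1 z) zZ add1n subn1 /=; apply: eq_card => w; rewrite !inE andbC.
  rewrite -sum_nat_const; apply: eq_bigr => w /andP[_ wz].
  rewrite -(@card_forms F N (z - w) 0); last by rewrite subr_eq0 eq_sym.
  apply: eq_bigr => u _; congr (nat_of_bool _).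
  by rewrite form_atDl -scaleN1r form_atZl mulN1r subr_eq0.
have Qvan u : (A <= kermx u)%MS -> Q u = (#|Z| * #|Z|)%N.
  move=> Au; rewrite -[RHS]sum_nat_const; apply: eq_bigr => z zZ.
  rewrite -sum1_card; apply: eq_bigr => w wZ.
  have k x : x \in Z -> form_at x u = 0.
    by move=> xZ; apply/eqP; rewrite -sub_ker_form (submx_trans (ZA _ xZ)).
  by rewrite !k ?eqxx.
have Qge u : ~~ (A <= kermx u)%MS -> (#|Z| * #|Z| <= (#|F| - 1) * Q u)%N.
  case/Zu=> s Zs; pose n (t : F) := (\sum_(z in Z) (form_at z u == t))%N.
  have ns : n s = 0%N by rewrite /n big1 // => z zZ; rewrite (negPf (Zs _ zZ)).
  have sn : (\sum_(t | t != s) n t = #|Z|)%N.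
    transitivity (\sum_t n t)%N; first by rewrite [RHS](bigD1 s) //= ns.
    rewrite exchange_big /= -sum1_card; apply: eq_bigr => z zZ.
    by rewrite (bigD1 (form_at z u)) //= eqxx big1 ?addn0 // => t; rewrite eq_sym => /negPf ->.
  have Qn : (Q u = \sum_(t | t != s) n t * n t)%N.
    transitivity (\sum_t n t * n t)%N; last by rewrite (bigD1 s) //= ns.
    transitivity (\sum_t \sum_(z in Z) \sum_(w in Z) (form_at z u == t) * (form_at w u == t))%N.
      rewrite exchange_big /=; apply: eq_bigr => z zZ; rewrite exchange_big /=.
      apply: eq_bigr => w wZ; rewrite (bigD1 (form_at z u)) //= eqxx mul1n eq_sym.
      by rewrite big1 ?addn0 // => t; rewrite [_ == t]eq_sym => /negPf ->.
    by apply: eq_bigr => t _; rewrite big_distrl /=; apply: eq_bigr => z _; rewrite big_distrr.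
  have card_ne : #|[pred t : F | t != s]| = (#|F| - 1)%N.
    by rewrite subn1 -(cardC1 s); apply: eq_card => t; rewrite !inE.
  (* Cauchy-Schwarz in the form [2 a b <= a^2 + b^2], with [a = (#|F| - 1) * n t] and [b = #|Z|], to
     be summed over the values [t] other than [s]. *)
  have cs t : (2 * (#|F| - 1) * #|Z| * n t <=
      (#|F| - 1) * (#|F| - 1) * (n t * n t) + #|Z| * #|Z|)%N.
    have := nat_Cauchy ((#|F| - 1) * n t) #|Z| => -[h _]; nia.
  have : (2 * (#|F| - 1) * #|Z| * #|Z| <=
      (#|F| - 1) * (#|F| - 1) * Q u + (#|F| - 1) * (#|Z| * #|Z|))%N.
    have -> : ((#|F| - 1) * (#|Z| * #|Z|) = \sum_(t | t != s) #|Z| * #|Z|)%N.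
      by rewrite sum_nat_const card_ne.
    by rewrite -{2}sn Qn !big_distrr -big_split /=; apply: leq_sum => t _; exact: cs.
  have m0 : (0 < #|F| - 1)%N by rewrite subn_gt0.
  by move=> h; rewrite -(leq_pmul2l m0); move: h m0; move: (#|F| - 1)%N #|Z| (Q u); nia.
(* A form vanishing on [A] separates no pair of [Z]; this yields the surplus
   [(#|F| - 2) * (#|Z| * #|Z|)]. *)
have : ((#|F| - 1) * \sum_u Q u >= #|Z| * #|Z| * #|F| ^ N +
    (#|F| - 2) * (#|Z| * #|Z|) * #|F| ^ (N - \rank A))%N.
  have -> : (#|Z| * #|Z| * #|F| ^ N = \sum_(u : 'cV[F]_N) #|Z| * #|Z|)%N.
    by rewrite sum_nat_const card_mx muln1 mulnC.
  rewrite -card_forms_vanishing !big_distrr -big_split /=.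
  apply: leq_sum => u _; have [Au|Au] := boolP (A <= kermx u)%MS.
    by rewrite Qvan // ?Au muln1 -mulSn -subSn // subSS.
  by rewrite ?(negPf Au) muln0 addn0 Qge.
rewrite sumQ; set z := #|Z| in Z0 *.
have -> : (#|F| ^ N = #|F| * #|F| ^ (\rank A).-1 * #|F| ^ (N - \rank A))%N.
  by rewrite -expnS prednK ?(ltnW rA) // -expnD subnKC ?rank_leq_col.
have -> : (#|F| ^ N.-1 = #|F| ^ (\rank A).-1 * #|F| ^ (N - \rank A))%N.
  rewrite -expnD; congr (_ ^ _)%N; have := rank_leq_col A; lia.
have : (0 < #|F| ^ (N - \rank A))%N by rewrite expn_gt0 (ltnW q2).
have : (#|F| <= #|F| ^ (\rank A).-1)%N.
  rewrite -[X in (X <= _)%N]expn1 leq_pexp2l ?(ltnW q2) //; lia.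
move: (#|F| ^ (\rank A).-1)%N (#|F| ^ (N - \rank A))%N => P M PF M0 h.
have {}h : (z * (P + (#|F| - 2)) <= (#|F| - 1) * (#|F| - 1) * P)%N.
  rewrite -(leq_pmul2r M0) -(@leq_pmul2l z) ?lt0n //.
  move: h q2 Z0; case: #|F| => [|[|q]] //; case: z => // z; rewrite !subSS !subn0; nia.
move: h q2 PF; case: #|F| => [|[|q]] // h _ PF.
(* Since [P] is at least the field order, [P + (#|F| - 2)] is at least [2 * (#|F| - 1)]. *)
have : (z * (2 * q.+1) <= q.+1 * q.+1 * P)%N by nia.
rewrite subSS subn0; nia.
Qed.

(** For [K = 2] this is one more than the number of nonzero vectors on [2 p] points over the prime
    field; each further dimension multiplies it by [p], which suits averaging over hyperplanes. *)
Definition gap_bound (p K : nat) : nat := (p ^ (K - 2) * (2 * p * (p - 1) + 1))%N.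

Definition is_indicator (F : finFieldType) (N p K : nat) (f : 'rV[F]_N -> 'F_p) (A : 'M[F]_N) :=
  \rank A = K /\ forall v, f v = ((v <= A)%MS)%:R.

(** * Induction step: from tangent hyperplanes to a subspace *)

Section InductionStep.
Variables (p N K : nat) (f : 'rV['F_p]_N -> 'F_p).
Hypotheses (p_pr : prime p) (K_ge2 : (2 <= K)%N) (KN : (K.+1 < N)%N).
Hypotheses (fK : subspace_comb K.+1 f) (f0 : f 0 = 1).
Hypothesis f_small : (support_card f < gap_bound p K.+1)%N.
Hypothesis IH : forall g : 'rV['F_p]_N -> 'F_p, subspace_comb K g -> g 0 = 1 ->
  (support_card g < gap_bound p K)%N -> exists A, is_indicator K g A.
Implicit Types (u : 'cV['F_p]_N) (v : 'rV['F_p]_N) (A : 'M['F_p]_N).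

Let fh (a : 'F_p) v : a != 0 -> f (a *: v) = f v.
Proof. exact: comb_hom fK. Qed.

Let one_neq0 : (1 : 'F_p) != 0. Proof. exact: oner_neq0. Qed.

Let rowsum m (U : 'M['F_p]_(m, N)) :
  (\sum_(v : 'rV['F_p]_N | (v <= U)%MS) 1 = p ^ \rank U)%N.
Proof. by rewrite sum_rowspace1 card_Fp. Qed.

Let tangent u A := is_indicator K (restrict f (kermx u)) A.

Lemma gap_boundS : gap_bound p K.+1 = (p * gap_bound p K)%N.
Proof. by rewrite /gap_bound mulnA -expnS; congr (p ^ _ * _)%N; lia. Qed.

Lemma tangent_rank u A : tangent u A -> \rank A = K. Proof. by case. Qed.

Lemma tangent_sub u A : tangent u A -> (A <= kermx u)%MS.
Proof.
case=> _ h; apply/rV_subP => v vA; have := h v; rewrite vA /restrict.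
by case: (v <= kermx u)%MS => //; rewrite mulr0 => /eqP; rewrite eq_sym (negPf one_neq0).
Qed.

Lemma tangent_val u A v : tangent u A -> (v <= A)%MS -> f v = 1.
Proof.
move=> t vA; have vu := submx_trans vA (tangent_sub t); case: t => _ /(_ v).
by rewrite vA /restrict vu mulr1.
Qed.

Lemma tangent_mem u A v : tangent u A -> (v <= kermx u)%MS -> f v != 0 -> (v <= A)%MS.
Proof.
case=> _ /(_ v); rewrite /restrict => h vu; move: h; rewrite vu mulr1 => ->.
by case: (v <= A)%MS => //; rewrite eqxx.
Qed.

Lemma small_tangent u : (support_card (restrict f (kermx u)) < gap_bound p K)%N ->
  exists A, tangent u A.
Proof.
apply: IH; first by apply: comb_restrict => //; exact: rank_ker_form_ge.
by rewrite /restrict f0 sub0mx mulr1.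
Qed.

Lemma exists_tangent : exists u A, tangent u A.
Proof.
have p2 := prime_gt1 p_pr.
(* If zero were the only support vector, the sum of [f] over the whole space would be [f 0 = 1]
   instead of zero. *)
have b1 : (1 < support_card f)%N.
  rewrite ltnNge; apply/negP => b1.
  have : \sum_(v | (v <= (1%:M : 'M['F_p]_N))%MS) f v = 0.
    apply: (comb_sum_eq0 p_pr _ fK); first by rewrite card_Fp.
    by rewrite mxrank1; lia.
  rewrite (bigD1 0) ?sub0mx //= f0 big1 => [|v /andP[_ v0]].
    by move/eqP; rewrite addr0 (negPf one_neq0).
  apply/eqP; apply: contraTT b1 => fv; rewrite -ltnNge support_cardE.
  by rewrite (bigD1 0) //= f0 one_neq0 (bigD1 v) //= fv.
have f0' : f 0 != 0 by rewrite f0.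
have [u hu] := exists_small_kernel fh f0' b1; exists u; apply: small_tangent.
by rewrite card_Fp // in hu; rewrite -(ltn_pmul2l (ltnW p2)) -gap_boundS (leq_ltn_trans hu).
Qed.

(** As [t] varies, a support vector outside [kermx u] lies in the kernel of exactly one
    [u' + t *: u]. Those inside form [A], and [p] copies of [A :&: kermx u'] have as many vectors as
    [A]. Hence the [p] section supports add up to that of [f], and one of them is small. *)
Lemma tangent_pencil u A u' : tangent u A -> ~~ (A <= kermx u')%MS ->
  exists t A', tangent (u' + t *: u) A'.
Proof.
move=> tA Au'; have p2 := prime_gt1 p_pr.
have sum_t : (\sum_(t : 'F_p) support_card (restrict f (kermx (u' + t *: u))) = support_card f)%N.
  under eq_bigr do rewrite support_card_ker.
  rewrite exchange_big /= support_cardE.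
  rewrite [LHS](bigID (fun v => (v <= kermx u)%MS)) [RHS](bigID (fun v => (v <= kermx u)%MS)) /=.
  congr (_ + _)%N; last first.
    apply: eq_bigr => v vu; rewrite -big_distrr /=.
    have vu0 : form_at v u != 0 by rewrite -sub_ker_form.
    rewrite (bigD1 (- form_at v u' / form_at v u)) //= form_atDr form_atZr divfK //.
    rewrite addrN eqxx big1 ?muln1 // => t tne; apply/eqP; rewrite eqb0.
    apply: contra tne; rewrite form_atDr form_atZr addr_eq0 -eqr_oppLR => /eqP e.
    by rewrite e mulfK.
  transitivity (\sum_(v | (v <= A)%MS) p * (form_at v u' == 0%R))%N.
    rewrite [RHS]big_mkcond [LHS]big_mkcond /=; apply: eq_bigr => v _.
    case: (boolP (v <= A)%MS) => vA.
      have vu := submx_trans vA (tangent_sub tA); rewrite vu (tangent_val tA vA) one_neq0.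
      have vu0 : form_at v u = 0 by apply/eqP; rewrite -sub_ker_form.
      under eq_bigr do rewrite mul1n form_atDr form_atZr vu0 mulr0 addr0.
      by rewrite sum_nat_const card_Fp.
    case: ifP => // vu; rewrite big1 // => t _.
    case: eqP => //= /eqP fv; by rewrite (tangent_mem tA vu fv) in vA.
  have cardA : (\sum_(v | (v <= kermx u)%MS) (f v != 0%R) = p ^ K)%N.
    rewrite -(tangent_rank tA) -rowsum.
    rewrite [RHS]big_mkcond [LHS]big_mkcond /=; apply: eq_bigr => v _.
    case: (boolP (v <= A)%MS) => vA.
      by rewrite (submx_trans vA (tangent_sub tA)) (tangent_val tA vA) one_neq0.
    case: ifP => // vu; case: eqP => //= /eqP fv; by rewrite (tangent_mem tA vu fv) in vA.
  rewrite cardA -big_distrr /=.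
  have -> : (\sum_(v | (v <= A)%MS) (form_at v u' == 0%R) = p ^ \rank (A :&: kermx u')%MS)%N.
    rewrite -rowsum.
    rewrite [RHS]big_mkcond [LHS]big_mkcond /=; apply: eq_bigr => v _.
    by rewrite sub_capmx sub_ker_form; case: (v <= A)%MS => //=; case: eqP.
  by rewrite -expnS -rank_cap_ker_form // (tangent_rank tA).
have [t ht|h] := pickP (fun t => support_card (restrict f (kermx (u' + t *: u))) < gap_bound p K)%N.
  by exists t; exact: small_tangent.
exfalso; move: f_small; rewrite -sum_t gap_boundS ltnNge => /negP[].
have -> : (p * gap_bound p K = \sum_(t : 'F_p) gap_bound p K)%N by rewrite sum_nat_const card_Fp.
apply: leq_sum => t _; by rewrite leqNgt h.
Qed.

Lemma tangent_cap u1 A1 u2 A2 : tangent u1 A1 -> tangent u2 A2 ->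
  (A1 :&: kermx u2 <= A2)%MS.
Proof.
move=> t1 t2; apply/rV_subP => v; rewrite sub_capmx => /andP[v1 v2].
by apply: tangent_mem t2 v2 _; rewrite (tangent_val t1 v1).
Qed.

(* [A2] is spanned by its intersections with [A] and [A1]. *)
Lemma tangent_span u A u1 A1 u2 A2 : tangent u A -> tangent u1 A1 -> tangent u2 A2 ->
  ~~ (A <= kermx u1)%MS -> ~~ (A <= kermx u2)%MS ->
  ~~ (A :&: kermx u1 <= A :&: kermx u2)%MS -> (A2 <= A + A1)%MS.
Proof.
move=> t t1 t2 n1 n2 n12.
have r1 := rank_cap_ker_form n1; have r2 := rank_cap_ker_form n2.
have rA := tangent_rank t; have rA1 := tangent_rank t1; have rA2 := tangent_rank t2.
pose C2 := (A :&: kermx u2)%MS; pose W := (A1 :&: kermx u2)%MS.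
have rW := rank_cap_ker_form_ge A1 u2.
have C2A2 : (C2 <= A2)%MS := tangent_cap t t2.
have WA2 : (W <= A2)%MS := tangent_cap t1 t2.
have WC2 : ~~ (W <= C2)%MS.
  apply: contra n12 => WC2.
  have WA : (W <= A)%MS := submx_trans WC2 (capmxSl _ _).
  have WC1 : (W <= A :&: kermx u1)%MS.
    rewrite sub_capmx WA; exact: submx_trans (capmxSl _ _) (tangent_sub t1).
  apply: submx_trans WC2; apply: submx_rank_ge WC1 _.
  by rewrite -ltnS -r1 rA -rA1.
have CW : (C2 + W <= A2)%MS by rewrite addsmx_sub C2A2.
have : (C2 < C2 + W)%MS by rewrite ltmxE addsmxSl /= addsmx_sub submx_refl.
move/rank_ltmx => lt; have A2CW : (A2 <= C2 + W)%MS.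
  by apply: submx_rank_ge CW _; rewrite rA2 -rA r2.
by apply: submx_trans A2CW _; apply: addsmxS; exact: capmxSl.
Qed.

Lemma comb_is_indicator_step : exists A, is_indicator K.+1 f A.
Proof.
have p2 := prime_gt1 p_pr; have cp := card_Fp p_pr.
have [u [A t]] := exists_tangent; have rA := tangent_rank t.
have [u' Au'] : exists u', ~~ (A <= kermx u')%MS.
  have A0 : A != 0 by rewrite -mxrank_eq0 rA; lia.
  have nzA : nz_row A != 0 by rewrite nz_row_eq0.
  have [w wu] := exists_form1 nzA.
  exists w; apply: contraNN (one_neq0) => Aw.
  by rewrite -wu -sub_ker_form (submx_trans (nz_row_sub A)).
(* [u] vanishes on [A], so adding multiples of [u] to a form does not change its zeros on [A]. *)
have form_A w s v : (v <= A)%MS -> form_at v (w + s *: u) = form_at v w.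
  move=> vA; have := submx_trans vA (tangent_sub t).
  by rewrite sub_ker_form form_atDr form_atZr => /eqP ->; rewrite mulr0 addr0.
have ker_A w s : (A :&: kermx (w + s *: u) :=: A :&: kermx w)%MS.
  apply/eqmxP/andP; split; apply/rV_subP => v; rewrite !sub_capmx !sub_ker_form;
    by case/andP=> vA; rewrite vA /= form_A.
have not_sub w s : ~~ (A <= kermx w)%MS -> ~~ (A <= kermx (w + s *: u))%MS.
  apply: contra => h; have : (A <= A :&: kermx (w + s *: u))%MS by rewrite sub_capmx submx_refl.
  by rewrite ker_A sub_capmx => /andP[].
have [s1 [A1 t1]] := tangent_pencil t Au'; set u1 := u' + s1 *: u in t1.
have n1 : ~~ (A <= kermx u1)%MS by exact: not_sub.
have r1 := rank_cap_ker_form n1; have rA1 := tangent_rank t1.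
have C1A1 := tangent_cap t t1.
have A1A : ~~ (A1 <= A)%MS.
  apply/negP => A1A; have : (A1 <= A :&: kermx u1)%MS by rewrite sub_capmx A1A tangent_sub.
  by move/mxrankS; rewrite rA1 -rA r1 ltnn.
have [e eA1 eA] : exists2 e : 'rV_N, (e <= A1)%MS & ~~ (e <= A)%MS.
  have /row_subPn[i hi] := A1A; exists (row i A1) => //; exact: row_sub.
have A1e : (A1 <= A + e)%MS.
  have rr : (\rank ((A :&: kermx u1) + e)%MS >= K)%N.
    have : (A :&: kermx u1 < (A :&: kermx u1) + e)%MS.
      rewrite ltmxE addsmxSl /= addsmx_sub submx_refl /=.
      by apply: contra eA => /submx_trans; apply; exact: capmxSl.
    by move/rank_ltmx; rewrite -rA r1.
  have : (A1 <= (A :&: kermx u1) + e)%MS.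
    by apply: submx_rank_ge; rewrite ?addsmx_sub ?C1A1 ?rA1.
  by move/submx_trans; apply; apply: addsmxS; rewrite ?capmxSl.
(* [P] contains both [A] and [A1]; it is the subspace whose indicator [f] will turn out to be. *)
pose P := (A + e)%MS.
have rP : \rank P = K.+1.
  have : (A < P)%MS by rewrite ltmxE addsmxSl /= addsmx_sub submx_refl.
  move/rank_ltmx; have := mxrank_adds_leqif A e => -[h _].
  by have := rank_leq_row e; move: h; rewrite -/P rA; lia.
(* Either [w] cuts [A] in the same subspace as [u1], and [A1] serves with the value [0]; or a
   tangent subspace [A2] through [A :&: kermx w] lies in [P] by [tangent_span]. Then [A2] is
   [P :&: kermx u2], which fixes the value [- form_at e u2]. *)
have value1 w : ~~ (A <= kermx w)%MS ->
    exists s, forall a, (a <= A)%MS -> form_at a w = s -> f (e + a) = 1.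
  move=> Aw; have [C12|C12] := boolP (A :&: kermx u1 <= A :&: kermx w)%MS.
    exists 0 => a aA aw; apply: (tangent_val t1); rewrite addmx_sub //.
    have rw := rank_cap_ker_form Aw.
    have : (A :&: kermx w <= A :&: kermx u1)%MS by apply: submx_rank_ge C12 _; rewrite -ltnS -rw r1.
    move=> h; apply: submx_trans C1A1; apply: submx_trans h.
    by rewrite sub_capmx aA sub_ker_form aw eqxx.
  have [s2 [A2 t2]] := tangent_pencil t Aw; set u2 := w + s2 *: u in t2.
  have n2 : ~~ (A <= kermx u2)%MS by exact: not_sub.
  have A2P : (A2 <= P)%MS.
    apply: submx_trans (tangent_span t t1 t2 n1 n2 _) _; first by rewrite (ker_A w s2).
    by rewrite addsmx_sub addsmxSl.
  exists (- form_at e u2) => a aA aw; apply: (tangent_val t2).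
  have rP2 : ~~ (P <= kermx u2)%MS by apply: contra n2; rewrite addsmx_sub => /andP[].
  have := rank_cap_ker_form rP2; have rA2 := tangent_rank t2 => rPu.
  have : (P :&: kermx u2 <= A2)%MS.
    by apply: submx_rank_ge; rewrite ?sub_capmx ?A2P ?tangent_sub // rA2 -ltnS -rPu rP.
  apply: submx_trans; rewrite sub_capmx sub_ker_form form_atDl.
  rewrite [form_at a _]form_A // aw subrr eqxx andbT.
  by rewrite addmx_sub ?addsmxSr // (submx_trans aA) ?addsmxSl.
pose Z := [set a : 'rV_N | (a <= A)%MS & f (e + a) != 1].
have cardZ : (2 * #|Z| <= (p - 1) * p ^ K.-1)%N.
  have := @card_missing_values _ _ A Z; rewrite cp rA; apply=> //.
    by move=> z; rewrite inE => /andP[].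
  move=> w /value1[s hs]; exists s => z; rewrite inE => /andP[zA].
  by apply: contra => /eqP /(hs _ zA) ->.
(* By homogeneity the vectors of [P] outside [A] form [p - 1] scaled copies of the coset [e + A]. *)
have bad : (\sum_(v | (v <= P)%MS) (f v != 1%R) = (p - 1) * #|Z|)%N.
  transitivity (\sum_(a : 'F_p) \sum_(y | (y <= A)%MS) (f (a *: e + y)%R != 1%R))%N.
    exact: sum_adds_line.
  rewrite (bigD1 0) //= big1 => [|y yA]; last first.
    by rewrite scale0r add0r (tangent_val t yA) eqxx.
  rewrite add0n (eq_bigr (fun=> #|Z|)) => [|a a0].
    by rewrite sum_nat_const card_nz_scalars cp subn1.
  rewrite (reindex_inj (scalerI a0)) /= -sum1_card [RHS]big_mkcond [LHS]big_mkcond /=.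
  apply: eq_bigr => y _; rewrite eqmx_scale // -scalerDr fh // inE.
  by case: (y <= A)%MS => //=; case: eqP.
pose g v := f v - ((v <= P)%MS)%:R.
have gK : subspace_comb K.+1 g by apply: comb_sub_indicator; rewrite ?rP.
have g0 : g 0 = 0 by rewrite /g f0 sub0mx subrr.
(* Subtracting the indicator of [P] removes the vectors of [P] where [f] is [1] and adds at most the
   exceptional ones, which are therefore counted twice. *)
have g_card : (support_card g + p ^ K.+1 <= support_card f + 2 * ((p - 1) * #|Z|))%N.
  rewrite -rP -(rowsum P) -bad !support_cardE.
  rewrite mul2n -addnn [X in (_ + X <= _)%N]big_mkcond [X in (_ <= _ + (X + X))%N]big_mkcond /= -!big_split /=.
    apply: leq_sum => v _; rewrite /g; case: (v <= P)%MS => /=; last by rewrite subr0.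
  by rewrite subr_eq0; case: eqP => [->|]; rewrite ?one_neq0 //=; case: (f v == 0).
(* The support of [g] is below [2 (p - 1)^2 p^(K-1)], whereas a nonzero [g] needs at least
   [2 (p - 1) p^K]. *)
exists P; split=> // v; apply/eqP; rewrite -subr_eq0; apply/negPn/negP => gv.
have pcp : (p %| #|'F_p|)%N by rewrite cp.
have := dual_weight_ge p_pr pcp (isT : (0 < K.+1)%N) KN gK g0 gv.
rewrite cp; move: f_small g_card cardZ; rewrite /gap_bound.
have -> : (K.+1 - 2 = K.-1)%N by lia.
have -> : (p ^ K.+1 = p * (p * p ^ K.-1))%N by rewrite -!expnS prednK //; lia.
have : (0 < p ^ K.-1)%N by rewrite expn_gt0 ltnW.
move: (p ^ K.-1)%N (support_card g) (support_card f) #|Z| p2 => X a b z.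
clear; case: p => [|p'] //; rewrite !subSS !subn0; nia.
Qed.

End InductionStep.

(** * From projective points to nonzero vectors *)

Lemma sum_vectors_points (F : finFieldType) (N : nat) (G : 'M[F]_N -> nat) :
  (\sum_(v : 'rV[F]_N | v != 0%R) G <<v>>%MS =
   (#|F| - 1) * \sum_(M : 'M[F]_N | (M == <<M>>%MS) && (\rank M == 1)) G M)%N.
Proof.
rewrite (partition_big (fun v : 'rV[F]_N => <<v>>%MS)
  (fun M : 'M[F]_N => (M == <<M>>%MS) && (\rank M == 1%N))) /=; last first.
  by move=> v v0; rewrite genmx_id eqxx genmxE rank_rV v0.
rewrite big_distrr /=; apply: eq_bigr => M /andP[/eqP MM /eqP rM].
transitivity (\sum_(v : 'rV[F]_N | (v <= M)%MS && (v != 0%R)) G M)%N.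
  apply: eq_big => [v|v /andP[_ /eqP ->] //].
  rewrite andbC; case: (boolP (v == 0)) => v0; rewrite ?andbF ?andbT //=.
  rewrite {1}MM; apply/eqP/idP=> [e|vM].
    by rewrite -(genmxE M) -e genmxE.
  apply/genmxP/andP; split=> //.
  by apply: submx_rank_ge vM _; rewrite rM rank_rV v0.
rewrite sum_nat_const; congr (_ * _)%N.
have := sum_rowspace1 M; rewrite rM expn1 (bigD1 0) ?sub0mx //= sum1_card => <-.
by rewrite addKn.
Qed.

(** * Pairing elements of different classes *)

Section Pairing.
Variables (T : finType) (C : eqType) (cls : T -> C).

(* Repeatedly pair up elements of the two largest classes. *)
Lemma pairing (j : nat) (X : {set T}) : (#|X| <= 2 * j)%N ->
  (forall c, #|[set x in X | cls x == c]| <= j)%N ->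
  exists s : seq (T * T), [/\ (size s <= j)%N,
    {in s, forall z, [/\ z.1 \in X, z.2 \in X & (z.1 == z.2) || (cls z.1 != cls z.2)]} &
    {in X, forall x, has (fun z => (x == z.1) || (x == z.2)) s}].
Proof.
elim: j X => [|j IH] X cX cC.
  by exists [::]; split=> // x; move: cX; rewrite muln0 leqn0 cards_eq0 => /eqP ->; rewrite inE.
pose fib (Y : {set T}) x := #|[set y in Y | cls y == cls x]|.
have [->|[x0 x0X]] := set_0Vmem X.
  by exists [::]; split=> // x; rewrite inE.
have [x xX' xmax] := arg_maxnP (fib X) x0X; have xX : x \in X := xX'.
pose X1 := [set y in X | cls y != cls x].
have step y : y \in X -> (y == x) || (cls y != cls x) ->
    (#|X :\ x :\ y| <= 2 * j)%N ->
    (forall c, #|[set z in X :\ x :\ y | cls z == c]| <= j)%N ->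
    exists s : seq (T * T), [/\ (size s <= j.+1)%N,
    {in s, forall z, [/\ z.1 \in X, z.2 \in X & (z.1 == z.2) || (cls z.1 != cls z.2)]} &
    {in X, forall x, has (fun z => (x == z.1) || (x == z.2)) s}].
  move=> yX yx c1 c2; have [s [s1 s2 s3]] := IH _ c1 c2; exists ((x, y) :: s); split=> //.
    move=> z; rewrite inE => /predU1P[->|/s2 [a b c]] /=.
      by split=> //; rewrite [x == y]eq_sym [cls x == cls y]eq_sym.
    by split=> //; [move: a | move: b]; rewrite !inE => /andP[_ /andP[]].
  move=> z zX /=; have [//|zx] := eqVneq z x; have [//|zy] := eqVneq z y.
  by apply: s3; rewrite !inE zx zy.
have small_fib y c : (forall z, z \in X -> cls z = c -> (fib X z <= j)%N \/
     (exists2 w, w \in [set x; y] :&: X & cls w = c)) ->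
    (#|[set z in X :\ x :\ y | cls z == c]| <= j)%N.
  move=> h; have [->|[z]] := set_0Vmem [set z in X :\ x :\ y | cls z == c]; first by rewrite cards0.
  rewrite !inE => /andP[/and3P[zy zx zX] /eqP zc].
  case: (h z zX zc) => [hz|[w]].
    apply: leq_trans hz; apply: subset_leq_card; apply/subsetP => t.
    by rewrite !inE zc => /andP[/and3P[_ _ ->] ->].
  rewrite !inE => /andP[wxy wX] wc.
  rewrite -ltnS; apply: leq_trans (cC c); apply: proper_card; apply/properP; split.
    by apply/subsetP => t; rewrite !inE => /andP[/and3P[_ _ ->] ->].
  by exists w; rewrite !inE ?wX ?wc ?eqxx //; case/orP: wxy => /eqP ->; rewrite eqxx ?andbF.
(* If [X] is a single class, it has at most [j.+1] elements and [x] is paired with itself. *)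
have [X10|[y0 y0X1]] := set_0Vmem X1.
  have allx z : z \in X -> cls z = cls x.
    move=> zX; apply/eqP; apply: contraT => ne.
    by have := X10; move/setP/(_ z); rewrite !inE zX ne.
  apply: (step x) => //; first by rewrite eqxx.
    have e : X = [set z in X | cls z == cls x].
      by apply/setP => z; rewrite !inE; case: (boolP (z \in X)) => // /allx ->; rewrite eqxx.
    have := cC (cls x); rewrite -e (cardsD1 x X) xX.
    have := subset_leq_card (subsetDl (X :\ x) [set x]); lia.
  move=> c; apply: small_fib => z zX <-; right; exists x; last by rewrite allx.
  by rewrite !inE eqxx.
have [y yX1' ymax] := arg_maxnP (fib X) y0X1; have yX1 : y \in X1 := yX1'.
have /andP[yX yx] : (y \in X) && (cls y != cls x) by move: yX1; rewrite inE.
have xy : y != x by apply: contraNneq yx => ->.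
apply: (step y) => //; first by rewrite yx orbT.
  have := cX; rewrite (cardsD1 x X) xX (cardsD1 y (X :\ x)) !inE xy yX; lia.
move=> c; apply: small_fib => z zX zc.
have [e|zx] := eqVneq (cls z) (cls x).
  by right; exists x; rewrite ?inE ?eqxx //= -e.
have [e|zy] := eqVneq (cls z) (cls y).
  by right; exists y; rewrite ?inE ?eqxx ?orbT //= -e.
left; rewrite leqNgt; apply/negP => zj.
have zX1 : z \in X1 by rewrite inE zX.
have h1 := xmax z zX; have h2 := ymax z zX1.
(* A third class with more than [j] elements would give three disjoint classes, at least [3 * j.+1]
   elements in a set of at most [2 * j.+1]. *)
have : (fib X x + fib X y + fib X z <= #|X|)%N.
  pose D w := [set t in X | cls t == cls w].
  have dis a b : cls a != cls b -> [disjoint D a & D b].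
    move=> ab; rewrite -setI_eq0; apply/eqP/setP => t; rewrite !inE.
    by case: (boolP (cls t == cls a)) => [/eqP ->|]; rewrite ?andbF //= (negPf ab) !andbF.
  have d1 := dis _ _ yx; have d2 := dis _ _ zx; have d3 := dis _ _ zy.
  rewrite /fib -/(D x) -/(D y) -/(D z).
  have e1 : #|D y :|: D x| = (#|D y| + #|D x|)%N by apply/eqP; rewrite (leq_card_setU (D y) (D x)).2.
  have e2 : #|D z :|: (D y :|: D x)| = (#|D z| + #|D y :|: D x|)%N.
    apply/eqP; rewrite (leq_card_setU (D z) (D y :|: D x)).2.
    by rewrite disjoints_subset setCU subsetI -!disjoints_subset d3 d2.
  have : (#|D z :|: (D y :|: D x)| <= #|X|)%N.
    by apply: subset_leq_card; rewrite !subUset; apply/and3P; split; apply/subsetP => t; rewrite inE => /andP[].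
  by rewrite e2 e1 [(#|D x| + _)%N]addnC addnC.
have {}h1 : (fib X z <= fib X x)%N := h1; have {}h2 : (fib X z <= fib X y)%N := h2.
by move: (fib X x) (fib X y) (fib X z) #|X| h1 h2 zj cX; clear; lia.
Qed.

End Pairing.

(** * Power sums and moments over the prime field *)

Section Moments.
Variable p : nat.
Hypothesis p_pr : prime p.

(** For [j > 0], scaling the variable by [x] multiplies the sum by [x ^+ j], and some nonzero [x]
    has [x ^+ j != 1] because ['X^j - 1] has at most [j < p - 1] roots. For [j = 0] the sum consists
    of [p] ones. *)
Lemma sum_pow_eq0 (j : nat) : (j < p.-1)%N -> \sum_(a : 'F_p) a ^+ j = 0.
Proof.
case: j => [|j] jp.
  under eq_bigr do rewrite expr0.
  by rewrite sumr_const card_Fp // -(pcharf0 (pchar_Fp p_pr)).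
have [x x0 xj] : exists2 x : 'F_p, x != 0 & x ^+ j.+1 != 1.
  have Xn0 : ('X^(j.+1) - 1%:P : {poly 'F_p}) != 0.
    by rewrite -size_poly_eq0 size_XnsubC.
  pose rs := [seq x <- enum 'F_p | x != 0].
  have urs : uniq rs by rewrite filter_uniq // enum_uniq.
  case: (boolP (all (root ('X^(j.+1) - 1%:P)) rs)) => [ar|].
    have := max_poly_roots Xn0 ar urs; rewrite size_XnsubC // size_filter.
    have : (count (fun x : 'F_p => x != 0%R) (enum 'F_p) = p.-1)%N.
      transitivity #|[pred a : 'F_p | a != 0]|; last by rewrite card_nz_scalars card_Fp.
      by rewrite cardE {2}/enum_mem size_filter enumT; apply: eq_count => x; rewrite inE.
    by move=> ->; lia.
  case/allPn=> x; rewrite mem_filter => /andP[x0 _] nr; exists x => //.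
  by move: nr; rewrite /root !hornerE subr_eq0.
have : \sum_(a : 'F_p) a ^+ j.+1 = x ^+ j.+1 * \sum_(a : 'F_p) a ^+ j.+1.
  rewrite {1}(reindex_inj (mulfI x0)) big_distrr /=.
  by apply: eq_bigr => a _; rewrite exprMn.
move/eqP; rewrite -subr_eq0 -{1}[\sum_a _]mul1r -mulrBl mulf_eq0 subr_eq0 eq_sym (negPf xj).
by move/eqP.
Qed.

Lemma coef_prod_linear (I : Type) (s : seq I) (b c : I -> 'F_p) :
  let P := \prod_(i <- s) (b i *: 'X + (c i)%:P) in
  (size P <= (size s).+1)%N /\ P`_(size s) = \prod_(i <- s) b i.
Proof.
elim: s => [|i s [IH1 IH2]] /=; first by rewrite !big_nil size_poly1 coef1.
rewrite !big_cons; split.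
  apply: leq_trans (size_polyMleq _ _) _.
  have : (size (b i *: 'X + (c i)%:P)%R <= 2)%N.
    apply: leq_trans (size_polyD _ _) _; rewrite geq_max.
    rewrite (leq_trans (size_scale_leq _ _)) ?size_polyX //.
    by rewrite (leq_trans (size_polyC_leq1 _)).
  by move=> h; have := leq_add h IH1; rewrite add2n; case: (_ + _)%N.
rewrite mulrDl coefD -scalerAl coefZ coefXM /= IH2 coefCM.
by rewrite [X in c i * X]nth_default ?mulr0 ?addr0.
Qed.

(* The sum over [a] only sees the top coefficient, hence does not depend on [c]. *)
Lemma sum_prod_linear (I : Type) (s : seq I) (b c : I -> 'F_p) : size s = p.-1 ->
  \sum_(a : 'F_p) \prod_(i <- s) (a * b i + c i) =
    (\prod_(i <- s) b i) * \sum_(a : 'F_p) a ^+ p.-1.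
Proof.
move=> sp; pose P := \prod_(i <- s) (b i *: 'X + (c i)%:P).
have [sP cP] := coef_prod_linear s b c; rewrite -/P sp in sP cP.
rewrite -cP; transitivity (\sum_(a : 'F_p) P.[a]).
  apply: eq_bigr => a _; rewrite /P horner_prod; apply: eq_bigr => i _.
  by rewrite !hornerE mulrC.
under eq_bigr do rewrite (horner_coef_wide _ sP).
rewrite exchange_big big_ord_recr /= -big_distrr /= big1 ?add0r // => i _.
by rewrite -big_distrr /= sum_pow_eq0 ?mulr0.
Qed.

(** Split off a line of [S]: by [sum_prod_linear] its translates all have the same sum, and their
    number is a positive power of [p]. *)
Lemma sum_subspace_prod_forms (N : nat) (S : 'M['F_p]_N) (us : seq 'cV['F_p]_N) :
  (2 <= \rank S)%N -> size us = p.-1 ->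
  \sum_(v | (v <= S)%MS) \prod_(u <- us) form_at v u = 0.
Proof.
move=> rS sus; pose e := nz_row S; pose S' := (S :\: e)%MS.
have e0 : e != 0 by rewrite nz_row_eq0 -mxrank_eq0; lia.
have eS : (e <= S)%MS := nz_row_sub S.
have capSe : (S :&: e :=: e)%MS by apply/capmx_idPr.
have SS' : (S :=: S' + e)%MS.
  by apply: eqmx_trans (adds_eqmx (eqmx_refl _) capSe); apply: eqmx_sym; exact: addsmx_diff_cap_eq.
have eS' : ~~ (e <= S')%MS.
  apply: contra e0 => eS'; have : (e <= S' :&: e)%MS by rewrite sub_capmx eS' submx_refl.
  by rewrite capmx_diff submx0.
under eq_bigl do rewrite SS'.
rewrite sum_adds_line // exchange_big /=.
under eq_bigr => y _.
  under eq_bigr => a _.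
    under eq_bigr do rewrite form_atDl form_atZl.
  over.
  rewrite sum_prod_linear //.
over.
rewrite sumr_const -mulr_natr [X in _ * X%:R](_ : _ = p ^ \rank S')%N; last first.
  transitivity (\sum_(v : 'rV['F_p]_N | (v <= S')%MS) 1)%N; first by rewrite sum1_card.
  by rewrite sum_rowspace1 card_Fp.
have : (0 < \rank S')%N.
  have := mxrank_sum_cap S' e; rewrite capmx_diff mxrank0 addn0 -SS' rank_rV e0; lia.
case: (\rank S') => // r _.
by rewrite expnS natrM (pcharf0 (pchar_Fp p_pr)) mul0r mulr0.
Qed.

Lemma comb_moment (N : nat) (f : 'rV['F_p]_N -> 'F_p) (us : seq 'cV['F_p]_N) :
  subspace_comb 2 f -> size us = p.-1 -> \sum_v f v * \prod_(u <- us) form_at v u = 0.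
Proof.
case=> s sK sf sus; under eq_bigr do rewrite sf big_distrl /=.
rewrite exchange_big big_seq big1 //= => x /sK /= rx.
under eq_bigr do rewrite -mulrA mulr_natl mulrb.
by rewrite -big_distrr -big_mkcond /= sum_subspace_prod_forms ?mulr0.
Qed.

End Moments.

Lemma exists_separating_form (F : finFieldType) (N m : nat) (U : 'M[F]_(m, N)) (v : 'rV[F]_N) :
  ~~ (v <= U)%MS -> exists2 u : 'cV[F]_N, (U <= kermx u)%MS & form_at v u != 0.
Proof.
rewrite submxE => h; have [j hj] : exists j, (v *m cokermx U) 0 j != 0.
  apply/existsP; apply: contraR h; rewrite negb_exists => /forallP h.
  by apply/eqP/rowP=> j; rewrite [RHS]mxE; apply/eqP; rewrite -[_ == _]negbK h.
exists (col j (cokermx U)).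
  by apply/sub_kermxP; rewrite colE mulmxA mulmx_coker mul0mx.
by rewrite /form_at colE mulmxA -colE mxE.
Qed.

(** * Base case: lines over the prime field *)

Section BaseCase.
Variables (p N : nat) (f : 'rV['F_p]_N -> 'F_p).
Hypotheses (p_pr : prime p) (N_gt2 : (2 < N)%N).
Hypotheses (fK : subspace_comb 2 f) (f0 : f 0 = 1).
Hypothesis f_small : (support_card f < gap_bound p 2)%N.
Implicit Types (Q v : 'rV['F_p]_N).

Let fh (a : 'F_p) v : a != 0 -> f (a *: v) = f v.
Proof. exact: comb_hom fK. Qed.

Let rowsum m (U : 'M['F_p]_(m, N)) :
  (\sum_(v : 'rV['F_p]_N | (v <= U)%MS) 1 = p ^ \rank U)%N.
Proof. by rewrite sum_rowspace1 card_Fp. Qed.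

(** The points of the support; homogeneity makes the choice of the vector [nz_row M] on a point
    immaterial. *)
Let B : {set 'M['F_p]_N} := [set M | [&& M == <<M>>%MS, \rank M == 1%N & f (nz_row M) != 0]].

Let f_point v : v != 0 -> f (nz_row <<v>>%MS) = f v.
Proof.
move=> v0; have : (nz_row <<v>>%MS <= v)%MS by rewrite -(genmxE v) nz_row_sub.
have nz : nz_row <<v>>%MS != 0 by rewrite nz_row_eq0 -mxrank_eq0 genmxE mxrank_eq0.
case/sub_rVP=> a e; rewrite e fh //; apply: contraNneq nz => a0.
by rewrite e a0 scale0r.
Qed.

Lemma mem_pointset v : v != 0 -> (<<v>>%MS \in B) = (f v != 0).
Proof. by move=> v0; rewrite inE genmx_id eqxx genmxE rank_rV v0 f_point. Qed.

Lemma card_pointset : support_card f = ((p - 1) * #|B| + 1)%N.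
Proof.
have := @sum_vectors_points 'F_p N (fun M => f (nz_row M) != 0%R).
rewrite card_Fp // => h; rewrite support_cardE (bigD1 0) //= f0 oner_neq0 addnC; congr (_ + _)%N.
rewrite -[RHS](_ : ((p - 1) * \sum_(M | (M == <<M>>%MS) && (\rank M == 1)) (f (nz_row M) != 0%R) = _)%N).
  by rewrite -h; apply: eq_bigr => v v0; rewrite f_point.
congr (_ * _)%N; rewrite -sum1_card big_mkcond [RHS]big_mkcond /=; apply: eq_bigr => M _.
by rewrite inE; case: eqP; case: eqP => //=; case: eqP.
Qed.

Lemma full_line Q : Q != 0 -> f Q != 0 ->
  exists L : 'M['F_p]_N, [/\ \rank L = 2%N, (Q <= L)%MS & forall v, (v <= L)%MS -> f v != 0].
Proof.
move=> Q0 fQ; have p2 := prime_gt1 p_pr.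
(* Classes are the lines through [Q]. *)
pose X := B :\ <<Q>>%MS; pose cls (M : 'M['F_p]_N) := <<(M + Q)%MS>>%MS.
(* [gap_bound p 2] allows at most [2 p - 1] support points, hence [2 (p - 1)] besides [Q]. *)
have cX : (#|X| <= 2 * p.-1)%N.
  have := f_small; rewrite card_pointset (cardsD1 <<Q>>%MS) mem_pointset // fQ -/X /gap_bound.
  rewrite subnn expn0 mul1n !addn1 ltnS mulnC ltn_pmul2r ?subn_gt0 // add1n.
  by move: #|X| => x; clear -p2; lia.
have Xpoint M : M \in X -> [/\ M = <<M>>%MS, \rank M = 1%N & ~~ (Q <= M)%MS].
  rewrite !inE => /and4P[MQ /eqP MM /eqP rM _]; split=> //.
  apply: contra MQ => QM; rewrite {1}MM; apply/eqP/genmxP/andP; split=> //.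
  by apply: submx_rank_ge QM _; rewrite rM rank_rV Q0.
have rcls M : M \in X -> \rank (M + Q)%MS = 2%N.
  case/Xpoint=> _ rM QM; have : (M < M + Q)%MS.
    by rewrite ltmxE addsmxSl /= addsmx_sub submx_refl.
  move/rank_ltmx; have := mxrank_adds_leqif M Q => -[h _].
  by move: h; rewrite rM rank_rV Q0; case: (\rank _) => [|[|[]]].
(* With [Q], [p] further support points on a line exhaust its [p + 1] points. *)
case: (boolP [exists c, p <= #|[set x in X | cls x == c]|]%N) => [/existsP[c hc]|].
  have [c0|[M0]] := set_0Vmem [set x in X | cls x == c].
    by move: hc; rewrite c0 cards0; lia.
  rewrite inE => /andP[M0X /eqP cM0].
  have rc : \rank c = 2%N by rewrite -cM0 genmxE rcls.
  have Qc : (Q <= c)%MS by rewrite -cM0 genmxE addsmxSr.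
  exists c; split=> // v vc; have [->|v0] := eqVneq v 0; first by rewrite f0 oner_neq0.
  have := @sum_vectors_points 'F_p N (fun M => (M <= c)%MS).
  rewrite card_Fp //.
  have -> : (\sum_(v : 'rV['F_p]_N | v != 0%R) (<<v>> <= c)%MS = p ^ 2 - 1)%N.
    have := sum_rowspace1 c; rewrite card_Fp // rc (bigD1 0) ?sub0mx //= => <-.
    rewrite addKn big_mkcond [RHS]big_mkcond /=; apply: eq_bigr => w _.
    by rewrite genmxE; case: (w <= c)%MS; case: (w == 0).
  have -> : (p ^ 2 - 1 = (p - 1) * (p + 1))%N by rewrite -subn_sqr exp1n.
  move/eqP; rewrite eqn_pmul2l ?subn_gt0 //.
  rewrite -big_mkcondr /= sum1_card => /eqP card_c.
  pose D := [set M : 'M['F_p]_N | (M == <<M>>%MS) && (\rank M == 1%N) && (M <= c)%MS].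
  have cD : #|D| = (p + 1)%N by rewrite card_c; apply: eq_card => M; rewrite inE.
  pose E := <<Q>>%MS |: [set x in X | cls x == c].
  have cE : (p + 1 <= #|E|)%N by rewrite cardsU1 addnC leq_add // inE in_setD1 eqxx.
  have ED : E \subset D.
    apply/subsetP => M; rewrite !inE => /orP[/eqP ->|/andP[/and4P[_ -> -> _] /eqP <-]] /=.
      by rewrite genmx_id eqxx genmxE rank_rV Q0 genmxE.
    by rewrite genmxE addsmxSl.
  have /eqP DE : E == D by rewrite eqEcard ED cD.
  have : <<v>>%MS \in D by rewrite inE genmx_id eqxx genmxE rank_rV v0 genmxE.
  rewrite -DE in_setU1 => /orP[/eqP e|]; last first.
    by rewrite inE => /andP[]; rewrite in_setD1 mem_pointset // => /andP[].
  by rewrite -f_point // e f_point.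
rewrite negb_exists => /forallP hc; exfalso.
have hc' c : (#|[set x in X | cls x == c]| <= p.-1)%N.
  by have := hc c; rewrite -ltnNge; lia.
have [s [ss s1 s2]] := pairing cX hc'.
(* Outside [s] any form nonzero at [Q] serves, which makes the choice of forms a total function. *)
have form_of z : {u : 'cV['F_p]_N | form_at Q u != 0 &
    (z \in s) ==> ((z.1 <= kermx u) && (z.2 <= kermx u))%MS}.
  apply: sig2W; have [zs|_] := boolP (z \in s); last first.
    by have [u hu] := exists_form1 Q0; exists u; rewrite ?hu ?oner_neq0.
  have [z1 z2 z12] := s1 _ zs.
  (* Otherwise the span of two distinct points would be the line joining [Q] to either, and they
     would share a class. *)
  have nQ : ~~ (Q <= z.1 + z.2)%MS.
    have [m1 r1 n1] := Xpoint _ z1; have [m2 r2 n2] := Xpoint _ z2.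
    case/orP: z12 => [/eqP <-|]; first by rewrite (addsmx_idPl (submx_refl z.1)).
    apply: contra => Qz; apply/eqP/genmxP.
    have r12 : (\rank (z.1 + z.2)%MS <= 2)%N.
      by have := mxrank_adds_leqif z.1 z.2 => -[h _]; rewrite r1 r2 in h.
    have a1 : (z.1 + Q <= z.1 + z.2)%MS by rewrite addsmx_sub addsmxSl.
    have a2 : (z.2 + Q <= z.1 + z.2)%MS by rewrite addsmx_sub addsmxSr.
    have b1 : (z.1 + z.2 <= z.1 + Q)%MS by apply: submx_rank_ge a1 _; rewrite rcls.
    have b2 : (z.1 + z.2 <= z.2 + Q)%MS by apply: submx_rank_ge a2 _; rewrite rcls.
    by rewrite (submx_trans a1 b2) (submx_trans a2 b1).
  have [u uU uQ] := exists_separating_form nQ; exists u => //=.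
  by move: uU; rewrite addsmx_sub.
have [u0 hu0] := exists_form1 Q0.
(* Padding with a form nonzero at [Q] gives exactly [p - 1] factors. *)
pose us := [seq s2val (form_of z) | z <- s] ++ nseq (p.-1 - size s) u0.
have sus : size us = p.-1 by rewrite size_cat size_map size_nseq subnKC.
have usQ : all (fun u => form_at Q u != 0) us.
  rewrite all_cat all_map; apply/andP; split.
    by apply/allP => z _ /=; case: (form_of z).
  by apply/allP => u /nseqP[-> _]; rewrite hu0 oner_neq0.
have kill v : f v != 0 -> ~~ (v <= Q)%MS -> \prod_(u <- us) form_at v u = 0.
  move=> fv vQ; have v0 : v != 0 by apply: contraNneq vQ => ->; rewrite sub0mx.
  have vX : <<v>>%MS \in X.
    rewrite in_setD1 mem_pointset // fv andbT; apply: contra vQ => /eqP e.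
    by rewrite -(genmxE Q) -e genmxE.
  have /hasP[z zs zv] := s2 _ vX.
  rewrite big_cat big_map /=; apply/eqP; rewrite mulf_eq0; apply/orP; left.
  rewrite prodf_seq_eq0; apply/hasP; exists z => //=; case: (form_of z) => u /= _; rewrite zs => /andP[k1 k2].
  rewrite -sub_ker_form -(genmxE v); by case/orP: zv => /eqP ->.
(* Only the [p - 1] nonzero multiples of [Q] survive, all with the same nonzero term since
   [a ^+ p.-1 = 1]; so the moment cannot vanish. *)
have := comb_moment p_pr fK sus.
rewrite (bigID (fun v => (v <= Q)%MS)) /= [X in _ + X]big1 ?addr0 => [|v vQ]; last first.
  by have [->|fv] := eqVneq (f v) 0; rewrite ?mul0r // kill ?mulr0.
rewrite sum_line // (bigD1 0) //= [X in X + _](_ : _ = 0) ?add0r; last first.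
  move: sus; case: (us) => [|u r] sus; first by move: sus p2 => /=; clear; lia.
  by rewrite big_cons scale0r form_at0l mul0r mulr0.
rewrite (eq_bigr (fun=> f Q * \prod_(u <- us) form_at Q u)) => [|a a0]; last first.
  rewrite fh //; congr (_ * _); under eq_bigr do rewrite form_atZl.
  rewrite big_split /= big_const_seq count_predT sus iter_mulr_1.
  have : a ^+ p.-1 = 1.
    apply: (mulfI a0); rewrite -exprS prednK ?mulr1 ?prime_gt0 //.
    by have := expf_card a; rewrite card_Fp.
  by move=> ->; rewrite mul1r.
rewrite sumr_const card_nz_scalars card_Fp // => /eqP; rewrite -mulr_natr !mulf_eq0 (negPf fQ) /=.
case/orP.
  by rewrite prodf_seq_eq0 => /hasP[u /(allP usQ) /negPf ->].
rewrite -(dvdn_pcharf (pchar_Fp p_pr)) => /dvdn_leq; lia.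
Qed.

Lemma comb_is_indicator_base : exists A, is_indicator 2 f A.
Proof.
have p2 := prime_gt1 p_pr; have cp := card_Fp p_pr.
have pcp : (p %| #|'F_p|)%N by rewrite cp.
have [Q Q0 fQ] : exists2 Q, Q != 0 & f Q != 0.
  case: (boolP [exists Q, (Q != 0) && (f Q != 0)]) => [/existsP[Q /andP[]]|].
    by exists Q.
  rewrite negb_exists => /forallP h.
  have : \sum_(v | (v <= (1%:M : 'M['F_p]_N))%MS) f v = 0.
    by apply: (comb_sum_eq0 p_pr pcp fK); rewrite mxrank1; lia.
  rewrite (bigD1 0) ?sub0mx //= f0 big1 => [/eqP|v /andP[_ v0]].
    by rewrite addr0 oner_eq0.
  by have := h v; rewrite v0 /= negbK => /eqP.
have [L [rL QL fL]] := full_line Q0 fQ.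
have outL v : ~~ (v <= L)%MS -> f v = 0.
  move=> vL; apply/eqP; apply: contraT => fv.
  have v0 : v != 0 by apply: contraNneq vL => ->; rewrite sub0mx.
  (* A second full line shares at most [p] vectors with [L], and [2 p^2 - p] support vectors are too
     many. *)
  have [L' [rL' vL' fL']] := full_line v0 fv; exfalso.
  have rcap : (\rank (L :&: L')%MS <= 1)%N.
    rewrite -ltnS -rL'; apply: rank_ltmx; rewrite ltmxE capmxSr /=.
    apply: contra vL => /(submx_trans vL'); by rewrite sub_capmx => /andP[].
  have : (p ^ 2 + p ^ 2 <= support_card f + p ^ \rank (L :&: L')%MS)%N.
    rewrite -{1}rL -rL' -!rowsum support_cardE.
    rewrite big_mkcond [X in (_ + X <= _)%N]big_mkcond [X in (_ <= _ + X)%N]big_mkcond /=.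
    rewrite -!big_split /=; apply: leq_sum => w _; rewrite sub_capmx.
    by case: (boolP (w <= L)%MS) => [/fL h1|_]; case: (boolP (w <= L')%MS) => [/fL' h2|_] //=; rewrite ?h1 ?h2.
  have : (p ^ \rank (L :&: L')%MS <= p ^ 1)%N by rewrite leq_pexp2l // ltnW.
  move: f_small; rewrite /gap_bound subnn expn0 mul1n expn1 -mulnn.
  move: (support_card f) (p ^ _)%N => x y; clear -p2; case: p p2 => // r; rewrite subSS subn0; nia.
exists L; split=> // v; apply/eqP; rewrite -subr_eq0; apply/negPn/negP => gv.
pose g v := f v - ((v <= L)%MS)%:R.
have gK : subspace_comb 2 g by apply: comb_sub_indicator; rewrite ?rL.
have g0 : g 0 = 0 by rewrite /g f0 sub0mx subrr.
have := dual_weight_ge p_pr pcp (isT : (0 < 2)%N) N_gt2 gK g0 gv.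
(* [g] lives on the nonzero vectors of [L], at most [p^2 - 1], short of the [2 p (p - 1)] that a
   nonzero [g] needs. *)
have : (support_card g + 1 <= p ^ 2)%N.
  have e1 : (\sum_(v : 'rV['F_p]_N) (v == 0%R))%N = 1%N.
    by rewrite (bigD1 0) //= eqxx big1 ?addn0 // => w /negPf ->.
  rewrite -[X in (_ + X <= _)%N]e1 -rL -(rowsum L) support_cardE [X in (_ <= X)%N]big_mkcond -big_split /=.
  apply: leq_sum => w _; have [->|w0] := eqVneq w 0; first by rewrite g0 eqxx sub0mx.
  rewrite addn0 /g; case: (boolP (w <= L)%MS) => [_|/outL ->]; first by case: eqP.
  by rewrite subr0 eqxx.
rewrite cp -mulnn; move: (support_card g) => x.
clear -p2; case: p p2 => // r r1; rewrite [(r.+1 - 1)%N]subn1 succnK => h1 h2.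
have e : (r.+1 * r.+1 - 1 = r * r + 2 * r)%N by rewrite mulSn mulnS; lia.
have : (r.+1 * (2 * r * r.+1) <= r.+1 * x)%N.
  by apply: leq_trans h2; rewrite e; clear; nia.
rewrite leq_pmul2l //; move: h1 r1; clear; nia.
Qed.

End BaseCase.

Theorem comb_is_indicator (p N K : nat) (f : 'rV['F_p]_N -> 'F_p) :
  prime p -> (2 <= K)%N -> (K < N)%N -> subspace_comb K f -> f 0 = 1 ->
  (support_card f < gap_bound p K)%N -> exists A, is_indicator K f A.
Proof.
move=> p_pr; elim: K f => [|K IH] // f K2 KN fK f0 fs.
have [K3|K1] := ltnP 1 K; last first.
  have e : K = 1%N by move: K1 K2; clear; lia.
  by rewrite e in fK fs KN *; exact: comb_is_indicator_base.
by apply: comb_is_indicator_step => // g; apply: IH => //; exact: ltnW.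
Qed.

(** * Restriction of scalars to the prime field *)

Section ScalarRestriction.
Variables (F : finFieldType) (p h : nat).
Hypotheses (p_pr : prime p) (card_F : #|F| = (p ^ h)%N).

Lemma exists_Fp_coordinates (n : nat) : exists (N : nat) (psi : 'rV['F_p]_N -> 'rV[F]_n),
  bijective psi /\ {morph psi : x y / x + y}.
Proof.
have pF := card_finPcharP card_F p_pr.
have [v2r lin [r2v rK vK]] := pprimeChar_vectAxiom pF.
have v2rD : {morph v2r : x y / x + y}.
  by move=> x y; have := lin 1 x y; rewrite !scale1r.
have r2vD : {morph r2v : x y / x + y}.
  by move=> x y; apply: (can_inj rK); rewrite v2rD !vK.
exists (n * _)%N, (fun v => \row_i r2v (row i (vec_mx v))); split.
  exists (fun w : 'rV[F]_n => mxvec (\matrix_i v2r (w 0 i))) => [v|w].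
    rewrite -[RHS]vec_mxK; congr mxvec; apply/row_matrixP => i.
    by rewrite rowK mxE vK.
  by apply/rowP => i; rewrite mxE mxvecK rowK rK.
by move=> x y; apply/rowP => i; rewrite !mxE -r2vD linearD /= linearD.
Qed.

(** Scalars of the prime field act by repeated addition. *)
Lemma additive_set_is_rowspace (N : nat) (P : pred 'rV['F_p]_N) :
  P 0 -> (forall x y, P x -> P y -> P (x + y)) ->
  exists A : 'M['F_p]_N, forall v, P v = (v <= A)%MS.
Proof.
move=> P0 PD; have PZ (a : 'F_p) x : P x -> P (a *: x).
  move=> Px; rewrite -[a]natr_Zp scaler_nat.
  by elim: (nat_of_ord a) => [|m IH]; rewrite ?mulr0n // mulrS PD.
exists (\sum_(v | P v) <<v>>)%MS => v; apply/idP/idP => [Pv|].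
  by apply: (sumsmx_sup v); rewrite ?genmxE.
case/sub_sumsmxP=> w ->; apply: (big_ind P) => // x Px.
have /sub_rVP[a ->] : (w x *m <<x>> <= x)%MS by rewrite (submx_trans (submxMl _ _)) ?genmxE.
exact: PZ.
Qed.

End ScalarRestriction.

(** * Codewords and their lifts to vectors *)

Section MainTheorem.
Variables (F : finFieldType) (p h n k : nat).
Hypotheses (p_pr : prime p) (h_gt0 : (0 < h)%N) (card_F : #|F| = (p ^ h)%N).
Hypotheses (k_gt0 : (0 < k)%N) (k_lt_n : (k < n)%N).
Variable a : {ffun 'M[F]_(n.+1) -> 'F_p}.

Let w := weight (comb k a).
Let g (v : 'rV[F]_n.+1) : 'F_p :=
  \sum_(S in proj_subspaces F n k) a S * ((v <= S)%MS)%:R.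

Let p_dvd_q : (p %| #|F|)%N.
Proof. by rewrite card_F; case: h h_gt0 => // m _; rewrite expnS dvdn_mulr. Qed.

Lemma weight_vectors : (\sum_(v | v != 0%R) (g v != 0%R) = (#|F| - 1) * w)%N.
Proof.
transitivity (\sum_(v : 'rV[F]_n.+1 | v != 0%R) (comb k a <<v>>%MS != 0%R))%N.
  apply: eq_bigr => v _; congr (nat_of_bool (_ != _)); apply: eq_bigr => S _.
  by rewrite genmxE.
rewrite (sum_vectors_points (fun M => comb k a M != 0%R)); congr (_ * _)%N.
rewrite /w /weight -sum1_card big_mkcond [RHS]big_mkcond /=; apply: eq_bigr => M _.
by rewrite !inE; case: (M == _); case: (\rank M == _) => //=; case: eqP.
Qed.

Lemma theta_mul : (theta #|F| k * (#|F| - 1) = #|F| ^ k.+1 - 1)%N.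
Proof. by rewrite /theta divnK // !subn1 predn_exp dvdn_mulr. Qed.

Lemma weight_zero_sum : g 0 = 0 -> (0 < w)%N ->
  (2 * (p - 1) * theta #|F| k + 2 <= p * w)%N.
Proof.
move=> g0 w0; have q2 := finNzRing_gt1 F.
have gK : subspace_comb k.+1 g.
  exists [seq (a U, U) | U <- enum (proj_subspaces F n k)].
    by move=> _ /mapP[U US ->]; move: US; rewrite mem_enum inE => /andP[_ /eqP rS] /=; rewrite rS.
  by move=> v; rewrite big_map big_enum.
have sg : support_card g = ((#|F| - 1) * w)%N.
  by rewrite -weight_vectors support_cardE (bigD1 0) //= g0 eqxx.
have [v gv] : exists v, g v != 0.
  apply/existsP; apply: contraLR w0; rewrite negb_exists => /forallP h0.
  have := sg; rewrite support_cardE big1 => [/eqP|v _]; last by apply/eqP; rewrite eqb0 h0.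
  by rewrite eq_sym muln_eq0 subn_eq0 leqNgt q2 /= => /eqP ->.
have kn : (k.+1 < n.+1)%N by [].
have := dual_weight_ge p_pr p_dvd_q (ltn0Sn k) kn gK g0 gv.
rewrite sg -theta_mul; have q1 : (0 < #|F| - 1)%N by rewrite subn_gt0.
move=> le; rewrite -(leq_pmul2l q1); move: le.
by move: (theta _ _) w (#|F| - 1)%N (p - 1)%N => t x y z; clear; nia.
Qed.

(** Over the prime field the scaled lift is the indicator of a subspace of rank [h * k.+1], hence
    with [#|F| ^ k.+1] vectors; this determines the weight. *)
Lemma weight_nonzero_sum : g 0 != 0 ->
  ((#|F| - 1) * w + 1 < gap_bound p (h * k.+1))%N -> w = theta #|F| k.
Proof.
move=> g0 small; have p2 := prime_gt1 p_pr; have q2 := finNzRing_gt1 F.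
have [N [psi [psi_bij psiD]]] := exists_Fp_coordinates p_pr card_F n.+1.
have [psi' psiK psi'K] := psi_bij.
have psi0 : psi 0 = 0 by apply: (addIr (psi 0)); rewrite -psiD !add0r.
have sum_psi (G : 'rV[F]_n.+1 -> nat) : (\sum_v G (psi v) = \sum_v G v)%N.
  by rewrite [RHS](reindex psi) //; exact: onW_bij.
have hN : N = (h * n.+1)%N.
  apply/eqP; rewrite -(eqn_exp2l _ _ p2) expnM -card_F -{1}(card_Fp p_pr); apply/eqP.
  by have := bij_eq_card psi_bij; rewrite !card_mx !mul1n.
(* An [F]-subspace pulls back to a set closed under addition, hence to a row space, whose rank is
   found by counting vectors. *)
have pull (S : 'M[F]_n.+1) : {A : 'M['F_p]_N | [forall v, (psi v <= S)%MS == (v <= A)%MS]}.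
  apply: sigW; have [||A hA] := @additive_set_is_rowspace p N (fun v => psi v <= S)%MS.
  - by rewrite psi0 sub0mx.
  - by move=> x y xS yS; rewrite psiD addmx_sub.
  by exists A; apply/forallP => v; rewrite hA.
have pullE S v : (psi v <= S)%MS = (v <= sval (pull S))%MS.
  by case: (pull S) => A /= /forallP/(_ v)/eqP.
have rank_pull S : \rank (sval (pull S)) = (h * \rank S)%N.
  apply/eqP; rewrite -(eqn_exp2l _ _ p2) expnM -card_F; apply/eqP.
  rewrite -sum_rowspace1 [RHS]big_mkcond -(sum_psi (fun v => if (v <= S)%MS then 1%N else 0%N)).
  have := sum_rowspace1 (sval (pull S)); rewrite card_Fp // => <-; rewrite big_mkcond.
  by apply: eq_bigr => v _; rewrite pullE.
pose f v : 'F_p := (g 0)^-1 * g (psi v).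
have fK : subspace_comb (h * k.+1) f.
  apply: comb_scale; exists [seq (a U, sval (pull U)) | U <- enum (proj_subspaces F n k)].
    by move=> _ /mapP[U US ->]; move: US; rewrite mem_enum inE => /andP[_ /eqP rS] /=; rewrite rank_pull rS.
  by move=> v; rewrite big_map big_enum /=; apply: eq_bigr => S _; rewrite pullE.
have f0 : f 0 = 1 by rewrite /f psi0 mulVf.
have sf : support_card f = ((#|F| - 1) * w + 1)%N.
  rewrite support_cardE; transitivity (\sum_v (g (psi v) != 0%R))%N.
    by apply: eq_bigr => v _; rewrite /f mulf_eq0 invr_eq0 (negPf g0).
  rewrite (sum_psi (fun v => (g v != 0%R) : nat)) (bigD1 0) //= g0 weight_vectors.
  by rewrite addnC.
rewrite -sf in small.
have K2 : (2 <= h * k.+1)%N by apply: (@leq_trans k.+1); rewrite ?leq_pmull.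
have KN : (h * k.+1 < N)%N by rewrite hN ltn_pmul2l // ltnS.
have [A [rA fA]] := comb_is_indicator p_pr K2 KN fK f0 small.
have : support_card f = (#|F| ^ k.+1)%N.
  have := sum_rowspace1 A; rewrite card_Fp // rA expnM -card_F => <-.
  rewrite support_cardE [RHS]big_mkcond /=; apply: eq_bigr => v _; rewrite fA.
  by case: (v <= A)%MS; rewrite ?oner_neq0 ?eqxx.
rewrite sf => e; apply/eqP; rewrite -(eqn_pmul2r (_ : 0 < #|F| - 1)%N) ?subn_gt0 //.
by rewrite theta_mul -e addnK mulnC.
Qed.

Lemma theta_ge : (#|F| < theta #|F| k)%N.
Proof.
have q2 := finNzRing_gt1 F; rewrite -(ltn_pmul2r (_ : 0 < #|F| - 1)%N) ?subn_gt0 // theta_mul.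
have : (#|F| ^ 2 <= #|F| ^ k.+1)%N by rewrite leq_pexp2l // ltnW.
rewrite -mulnn mulnBr muln1; move: (#|F| ^ k.+1)%N q2 => X; move: #|F| => q; clear; nia.
Qed.

End MainTheorem.

(* Numerical estimates and conclusion *)
Local Close Scope ring_scope.

(** After multiplication by [7], [14 (p - 1) y] exceeds [12 p y] by [(2 p - 14) y], more than [6 p],
    while the constants cost less than [5 p]. *)
Lemma dual_weight_arith (p x y : nat) : 9 < p -> p < y -> 7 * x < 12 * y + 6 ->
  2 * (p - 1) * y + 2 <= p * x -> False.
Proof.
case: p => [//|r]; rewrite [r.+1 - 1]subn1 succnK => r9 ry xy le.
have : 7 * (2 * r * y + 2) <= r.+1 * (7 * x) by move: le; clear; nia.
have : r.+1 * (7 * x) <= r.+1 * (12 * y + 5) by rewrite leq_pmul2l //; move: xy; clear; lia.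
have : 9 * y <= r * y by rewrite leq_mul2r -ltnS r9 orbT.
have : r * r.+2 <= r * y by rewrite leq_mul2l ry orbT.
by move: r9 ry; clear; nia.
Qed.

(** Here [q] is the field order minus one and [Z] is [p ^ (K - 2)]. The main term [12/7 * 49 Z] is
    [84 Z]; the last [Z] of the bound [85 Z] absorbs the rest. *)
Lemma gap_arith7 (q x y Z : nat) : 7 * x < 12 * y + 2 -> y * q = 7 * (7 * Z) - 1 ->
  q.+1 <= 7 * Z -> 0 < Z -> q * x + 1 < Z * (2 * 7 * (7 - 1) + 1).
Proof.
move=> xy yq qZ Z0; have : q * (7 * x) <= q * (12 * y + 1) by rewrite leq_mul2l -ltnS -addnS xy orbT.
by move: yq qZ Z0; clear; nia.
Qed.

(** The decisive comparison is [12 p^2 + 5 p <= 7 (2 p (p - 1) + 1)], true from [p = 10] on. *)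
Lemma gap_arith (p q x y Z : nat) : 9 < p -> 7 * x < 12 * y + 6 -> y * q = p * (p * Z) - 1 ->
  q.+1 <= p * Z -> 0 < Z -> q * x + 1 < Z * (2 * p * (p - 1) + 1).
Proof.
case: p => [//|r]; rewrite [r.+1 - 1]subn1 succnK => r9 xy yq qZ Z0.
have : q * (7 * x) <= q * (12 * y + 5) by rewrite leq_mul2l -ltnS -addnS xy orbT.
have h1 : 9 * Z <= r * Z by rewrite leq_mul2r -ltnS r9 orbT.
have : r * (9 * Z) <= r * (r * Z) by rewrite leq_mul2l h1 orbT.
by move: h1 yq qZ Z0; clear; nia.
Qed.

Theorem mainTheorem5 (F : finFieldType) (p h n k : nat) :
  prime p -> 0 < h -> #|F| = p ^ h ->
  2 <= n -> 1 <= k <= n - 1 ->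
  forall a : {ffun 'M[F]_(n.+1) -> 'F_p},
    let w := weight (comb k a) in
    let t := theta #|F| k in
    (p = 7 -> ~ (t < w /\ 7 * w < 12 * t + 2)) /\
    (7 < p -> ~ (t < w /\ 7 * w < 12 * t + 6)).
Proof.
move=> p_pr h_gt0 card_F n2 /andP[k1 kn] a w t.
have k_lt_n : k < n by move: n2 kn; clear; lia.
have p2 := prime_gt1 p_pr; have q2 := finNzRing_gt1 F.
have lt_qt : #|F| < t := theta_ge F k1.
have pq : p <= #|F| by rewrite card_F -{1}[p]expn1 leq_pexp2l // ltnW.
have zero_sum := weight_zero_sum p_pr h_gt0 card_F k_lt_n (a := a).
have nonzero_sum := weight_nonzero_sum p_pr h_gt0 card_F k1 k_lt_n (a := a).
rewrite -/w -/t in zero_sum nonzero_sum.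
set g0 := (\sum_(S in _) _)%R in zero_sum nonzero_sum.
have p_ge10 : 7 < p -> 9 < p.
  have p8 : p != 8 by apply: contraTneq p_pr => ->.
  have p9 : p != 9 by apply: contraTneq p_pr => ->.
  by move: p8 p9; clear; lia.
have [e|ne] := eqVneq g0 0%R.
  have pt : p < t := leq_ltn_trans pq lt_qt.
  split=> p7 [w1 w2]; have := zero_sum e (leq_ltn_trans (leq0n t) w1).
    (* For [p = 7] the bound is exactly [12 t + 2 <= 7 w]. *)
    by rewrite p7; move: w2; clear; lia.
  exact: dual_weight_arith (p_ge10 p7) pt w2.
have {zero_sum}nz := nonzero_sum ne.
(* The power in [gap_bound] for the rank [h * k.+1] over the prime field. *)
pose Y := p ^ (h * k.+1 - 2).
have Yp : p * (p * Y) = #|F| ^ k.+1.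
  have : 2 <= h * k.+1 by apply: (@leq_trans k.+1); rewrite ?leq_pmull.
  by move=> K2; rewrite /Y -!expnS card_F -expnM; congr (p ^ _); move: K2; clear; lia.
have qY : #|F| <= p * Y.
  have : 2 * h <= h * k.+1 by rewrite mulnC leq_mul.
  move=> K2; rewrite /Y card_F -expnS leq_pexp2l ?(ltnW p2) //; move: K2 h_gt0; clear; lia.
have tq := theta_mul F k; rewrite -/t -Yp in tq.
have Y0 : 0 < Y by rewrite /Y expn_gt0 ltnW.
rewrite /gap_bound -/Y in nz.
have q1 : 0 < #|F| - 1 by rewrite subn_gt0.
have qS : #|F| = (#|F| - 1).+1 by rewrite subn1 prednK // ltnW.
rewrite qS in qY.
split=> p7 [w1 w2]; move: (w1); rewrite nz ?ltnn //.
  by rewrite p7 in tq qY nz Y0 *; exact: gap_arith7 w2 tq qY Y0.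
exact: gap_arith (p_ge10 p7) w2 tq qY Y0.
Qed.
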